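(* Let $T$ be a Turing machine universal for the class of all Turing machines and let $s>1$ be a computable real. Then $\langle\kappa_T\rangle(s)=(1-2^{-s+1})\sum_{p\in\mathrm{dom}(T)}2^{-s|p|}$ is $1/s$-$K$-random.
   Context: Turing machines map binary strings to binary strings (partial functions on $\Sigma^*$, $\Sigma=\{0,1\}$); $\mathrm{dom}(M)$ is the set of inputs on which $M$ halts. A Turing machine $W$ is universal for a class $\Re$ if for every $C\in\Re$ there is $c\ge0$ such that for every $x\in\mathrm{dom}(C)$ there is $p_x\in\mathrm{dom}(W)$ with $|p_x|\le|x|+c$ and $W(p_x)=C(x)$. The plain complexity is $K_T(x)=\min\{|w|:T(w)=x\}$. For $\alpha\in(0,1)$, $\alpha[m]$ is the first $m$ bits of its unending binary expansion. For a computable real $s>1$, $\alpha$ is $1/s$-$K$-random if there is a constant $c\ge0$ with $K_T(\alpha[m])\ge m/s-c$ for all $m\ge1$ (complexity taken with respect to the fixed universal Turing machine $T$). *)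

(* Defs.v *)
From mathcomp Require Import all_boot all_order all_algebra.
From mathcomp Require Import all_classical all_reals all_analysis.

Set Implicit Arguments.
Unset Strict Implicit.
Unset Printing Implicit Defensive.

Import Order.TTheory GRing.Theory Num.Theory.
Import numFieldNormedType.Exports.

Local Open Scope classical_set_scope.
Local Open Scope ring_scope.

Inductive dir := MoveL | Stay | MoveR.

(* A deterministic Turing machine with finitely many (at least one) two-way
   infinite tapes.  The cell alphabet is option (bool + tm_aux): None is the
   blank, Some (inl b) the bit b, Some (inr a) an auxiliary symbol. *)
Record TM := MkTM {
  tm_tapes : nat; (* the machine has tm_tapes.+1 tapes *)
  tm_state : finType;
  tm_aux : finType;
  tm_start : tm_state;
  tm_halt : pred tm_state;
  tm_delta : tm_state ->
    {ffun 'I_tm_tapes.+1 -> option (bool + tm_aux)} ->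
    tm_state * ('I_tm_tapes.+1 -> option (bool + tm_aux) * dir)
}.

(* Cells beyond both lists are blank; [tape_left] is read away from the head. *)
Record tape (A : Type) := Tape {
  tape_left : seq (option A);
  tape_head : option A;
  tape_right : seq (option A)
}.

Definition tape_write (A : Type) (a : option A) (t : tape A) : tape A :=
  Tape (tape_left t) a (tape_right t).

Definition tape_move (A : Type) (d : dir) (t : tape A) : tape A :=
  let: Tape l a r := t in
  match d with
  | MoveL => Tape (behead l) (head None l) (a :: r)
  | Stay => t
  | MoveR => Tape (a :: l) (head None r) (behead r)
  end.

Definition input_tape (A : Type) (x : seq bool) : tape (bool + A) :=
  let cells := [seq Some (inl b) | b <- x] in
  Tape [::] (head None cells) (behead cells).

Fixpoint leading_bits (A : Type) (cells : seq (option (bool + A))) : seq bool :=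
  if cells is Some (inl b) :: cells' then b :: leading_bits cells' else [::].

(* The output is the longest block of bits starting at the scanned cell. *)
Definition tape_output (A : Type) (t : tape (bool + A)) : seq bool :=
  leading_bits (tape_head t :: tape_right t).

Section Run.
Variable M : TM.

Record config := Config {
  cf_state : tm_state M;
  cf_tapes : 'I_(tm_tapes M).+1 -> tape (bool + tm_aux M)
}.

(* Tape 0 serves as both input and output tape. *)
Definition tm_init (x : seq bool) : config :=
  Config (tm_start M)
    (fun i => input_tape (tm_aux M) (if i == ord0 then x else [::])).

Definition tm_step (c : config) : config :=
  if tm_halt (cf_state c) then c else
  let: (q, act) :=
    tm_delta (cf_state c) [ffun i => tape_head (cf_tapes c i)] in
  Config q
    (fun i => tape_move (act i).2 (tape_write (act i).1 (cf_tapes c i))).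

Definition tm_run (x : seq bool) (n : nat) : config :=
  iter n tm_step (tm_init x).

Definition tm_halts (x : seq bool) (n : nat) : bool :=
  tm_halt (cf_state (tm_run x n)).

Definition tm_dom : set (seq bool) := [set x | exists n, tm_halts x n].

Definition computes (x y : seq bool) : Prop :=
  exists2 n, tm_halts x n & tape_output (cf_tapes (tm_run x n) ord0) = y.

End Run.

Definition universal_for (Re : TM -> Prop) (W : TM) : Prop :=
  forall C : TM, Re C -> exists c : nat,
    forall x, tm_dom C x -> exists p, [/\ tm_dom W p,
      (size p <= size x + c)%N & forall y, computes C x y -> computes W p y].

Section Reals.
Variable R : realType.

Definition bin_value (y : seq bool) : nat :=
  foldl (fun n (b : bool) => (n.*2 + b)%N) 0%N y.

(* The first bit of y is a sign, the others a binary numerator over 2^n. *)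
Definition dyadic (n : nat) (y : seq bool) : R :=
  (-1) ^+ head false y * (bin_value (behead y))%:R / 2 ^+ n.

Definition computable_real (a : R) : Prop :=
  exists M : TM, forall n : nat, exists2 y,
    computes M (nseq n true) y & `|a - dyadic n y| <= 2 ^- n.

(* The minimum is +oo when x is not an output of T. *)
Definition plainK (T : TM) (x : seq bool) : \bar R :=
  ereal_inf [set ((size w)%:R : R)%:E | w in [set w | computes T w x]].

(* "Unending" selects, for a dyadic rational, the expansion with infinitely
   many ones, so that the expansion is unique. *)
Definition unending_expansion (a : R) (b : nat -> bool) : Prop :=
  (forall N, exists2 i, (N <= i)%N & b i) /\
  \sum_(0 <= i < n) (b i)%:R / 2 ^+ i.+1 @[n --> \oo] --> a.

(* e-K-randomness; mkseq b m is the string of the first m bits. *)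
Definition K_random (T : TM) (e a : R) : Prop :=
  0 < a < 1 /\
  exists2 b, unending_expansion a b &
    exists2 c : R, 0 <= c & forall m : nat, (1 <= m)%N ->
      ((m%:R * e - c)%:E <= plainK T (mkseq b m))%E.

(* The family is summable for s > 1, there being at most 2^n programs of
   length n; [fine] then only casts the sum to R. *)
Definition kappa (T : TM) (s : R) : R :=
  (1 - 2 `^ (- s + 1)) *
  fine (\esum_(p in tm_dom T) (2 `^ (- s * (size p)%:R))%:E)%E.

End Reals.

(* Main.v *)
(* If T(w) = alpha[m], then from w one can enumerate dom(T) until the enumerated
   part D of dom(T) accounts for more than 0.alpha[m] of the sum alpha.  What is
   left is less than 2^-m, so that a program p outside D has
   2^(-s|p|) = O(2^-m), that is, |p| >= m/s - O(1).  Any string not output by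
   a program in D therefore has complexity at least m/s - O(1), and one
   can be computed from w, so |w| >= m/s - O(1) by universality of T.

   The sum is a function of lambda = 2^-s alone, namely
   (1 - 2 lambda) sum_p lambda^|p|, so the search only has to find, along with a
   number of steps, rationals t/2^e <= lambda <= (t+2)/2^e certified by an
   approximation of s.

   alpha < 1 amounts to T not being total: were T total, its outputs on the
   strings of length at most 2|x| would be computable from x, and so would be a
   string outside them, against universality. *)
Require Import Defs.
From mathcomp Require Import all_boot all_order all_algebra.
From mathcomp Require Import all_classical all_reals all_analysis.
From mathcomp Require Import zify ring lra.
Set Implicit Arguments.
Unset Strict Implicit.
Unset Printing Implicit Defensive.
Import Order.TTheory GRing.Theory Num.Theory.
Import numFieldNormedType.Exports.
Local Open Scope classical_set_scope.
Local Open Scope ring_scope.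

(** * Stack programs and their compilation to Turing machines *)

(** Universality speaks of Turing machines, so each search has to become one. The bridge is
    arithmetic: functions computed by counters in unary registers are closed under enough operations
    to express a bounded simulation of any machine, and a single construction of an unbounded search
    then yields both machines. Running time is irrelevant, so encodings are chosen for short proofs,
    and their inverses are found by bounded search.

    Comparisons with lambda or with the sum cannot in general be decided from approximations of s,
    but strict inequalities can be confirmed. The search therefore looks for a certificate whose
    check compares integers. A certificate exists because the truncated unending expansion lies
    strictly below alpha; and every certificate is sound, whichever is met first. One number N
    bounds both the steps and the codes of the programs considered, so that the enumerated part is a
    finite sum.

    The final constant is c + d/s, with c from universality and 2^-d < 1 - 2 lambda. *)

Inductive prog :=
  | Skip
  | Push of nat & bool
  | Pop of nat
  | Seq of prog & prog
  | While of nat & prog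
  | If of nat & prog & prog.

Definition store := nat -> seq bool.

Definition upd (st : store) (k : nat) (s : seq bool) : store :=
  fun j => if j == k then s else st j.

Inductive exec : prog -> store -> store -> Prop :=
  | ExecSkip st : exec Skip st st
  | ExecPush st i b : exec (Push i b) st (upd st i (b :: st i))
  | ExecPop st i : exec (Pop i) st (upd st i (behead (st i)))
  | ExecSeq p q st1 st2 st3 :
      exec p st1 st2 -> exec q st2 st3 -> exec (Seq p q) st1 st3
  | ExecWhileNil i p st : st i = [::] -> exec (While i p) st st
  | ExecWhile i p st1 st2 st3 : st1 i <> [::] ->
      exec p st1 st2 -> exec (While i p) st2 st3 -> exec (While i p) st1 st3
  | ExecIfT i p q st1 st2 :
      head false (st1 i) -> exec p st1 st2 -> exec (If i p q) st1 st2
  | ExecIfF i p q st1 st2 :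
      ~~ head false (st1 i) -> exec q st1 st2 -> exec (If i p q) st1 st2.

Fixpoint max_reg (p : prog) : nat :=
  match p with
  | Skip => 0
  | Push i _ | Pop i => i
  | Seq p q => maxn (max_reg p) (max_reg q)
  | While i p => maxn i (max_reg p)
  | If i p q => maxn i (maxn (max_reg p) (max_reg q))
  end%N.

(** * Finite control with one tape per register *)

Section Compile.
Variable K : nat.

Let cell : Type := option (bool + void).
Let heads := {ffun 'I_K.+1 -> option (bool + void)}.
Let action := 'I_K.+1 -> cell * dir.
Let tapes := 'I_K.+1 -> tape (bool + void).

Definition act_on (i : nat) (f : cell -> cell * dir) (h : heads) : action :=
  fun o => if val o == i then f (h o) else (h o, Stay).

Definition act_none (h : heads) : action := fun o => (h o, Stay).

(** A machine step writes before it moves, so [Push] needs two states: move left, then write on the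
    new cell. The extra state [None] of [While] and [If] performs the test. *)
Fixpoint ctrl (p : prog) : finType :=
  match p with
  | Skip | Pop _ => unit
  | Push _ _ => bool
  | Seq p q => (ctrl p + ctrl q)%type
  | While _ p => option (ctrl p)
  | If _ p q => option (ctrl p + ctrl q)%type
  end.

Fixpoint ctrl_start (p : prog) : ctrl p :=
  match p with
  | Skip | Pop _ => tt
  | Push _ _ => false
  | Seq p q => inl (ctrl_start p)
  | While _ _ => None
  | If _ _ _ => None
  end.

(* [None] as a control state means that the program has terminated. *)
Fixpoint ctrl_step (p : prog) : ctrl p -> heads -> option (ctrl p) * action :=
  match p with
  | Skip => fun _ h => (None, act_none h)
  | Pop i => fun _ h => (None, act_on i (fun a => (a, MoveR)) h)
  | Push i b => fun x h =>
      if x then (None, act_on i (fun=> (Some (inl b), Stay)) h)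
      else (Some true, act_on i (fun a => (a, MoveL)) h)
  | Seq p q => fun x h =>
      match x with
      | inl y => let: (o, a) := @ctrl_step p y h in
          (Some (if o is Some z then inl z else inr (ctrl_start q)), a)
      | inr y => let: (o, a) := @ctrl_step q y h in
          (if o is Some z then Some (inr z) else None, a)
      end
  | While i p => fun x h =>
      match x with
      | None => (if h (inord i) is None then None
                 else Some (Some (ctrl_start p)), act_none h)
      | Some y => let: (o, a) := @ctrl_step p y h in (Some o, a)
      end
  | If i p q => fun x h =>
      match x with
      | None => (Some (Some (if h (inord i) is Some (inl true)
                   then inl (ctrl_start p) else inr (ctrl_start q))),
                 act_none h)
      | Some (inl y) => let: (o, a) := @ctrl_step p y h in
          (if o is Some z then Some (Some (inl z)) else None, a)
      | Some (inr y) => let: (o, a) := @ctrl_step q y h in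
          (if o is Some z then Some (Some (inr z)) else None, a)
      end
  end.

Definition heads_of (t : tapes) : heads := [ffun i => tape_head (t i)].

Definition act_tapes (a : action) (t : tapes) : tapes :=
  fun i => tape_move (a i).2 (tape_write (a i).1 (t i)).

Inductive reach (S : Type) (tr : S -> heads -> option S * action) :
    option S -> tapes -> option S -> tapes -> Prop :=
  | ReachRefl o t : reach tr o t o t
  | ReachStep x t o t' :
      reach tr (tr x (heads_of t)).1 (act_tapes (tr x (heads_of t)).2 t) o t' ->
      reach tr (Some x) t o t'.

Lemma reach_trans S (tr : S -> heads -> option S * action) o1 t1 o2 t2 o3 t3 :
  reach tr o1 t1 o2 t2 -> reach tr o2 t2 o3 t3 -> reach tr o1 t1 o3 t3.
Proof. by elim=> [//|x t o t' _ IH /IH]; exact: ReachStep. Qed.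

(** [phi] acts on [None] as well, so that leaving a subprogram can mean entering whatever follows it
    in the compound program. *)
Lemma reach_lift S S' (tr : S -> heads -> option S * action)
    (tr' : S' -> heads -> option S' * action) (phi : option S -> option S')
    (phi0 : S -> S') o t o' t' :
  (forall x, phi (Some x) = Some (phi0 x)) ->
  (forall x h, tr' (phi0 x) h = (phi (tr x h).1, (tr x h).2)) ->
  reach tr o t o' t' -> reach tr' (phi o) t (phi o') t'.
Proof.
move=> phiS trE; elim=> [? ?|x t1 o1 t2 _ IH]; first exact: ReachRefl.
by rewrite phiS; apply: ReachStep; rewrite trE.
Qed.

(* Only the scanned cell and the cells to its right hold the stack. *)
Definition represents (t : tapes) (st : store) : Prop :=
  forall (o : 'I_K.+1) j,
    nth None (tape_head (t o) :: tape_right (t o)) j =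
    nth None [seq Some (inl b) | b <- st o] j.

Lemma represents_head t st (o : 'I_K.+1) : represents t st ->
  tape_head (t o) = head None [seq Some (inl b) | b <- st o].
Proof. by move/(_ o 0); rewrite nth0. Qed.

Lemma act_tapes_none t : act_tapes (act_none (heads_of t)) t = t.
Proof.
apply/funext => i; rewrite /act_tapes /act_none /heads_of ffunE /=.
by case: (t i).
Qed.

Lemma act_tapes_on i f (t : tapes) o :
  act_tapes (act_on i f (heads_of t)) t o =
  if val o == i then
    tape_move (f (tape_head (t o))).2 (tape_write (f (tape_head (t o))).1 (t o))
  else t o.
Proof.
rewrite /act_tapes /act_on /heads_of ffunE; case: ifP => //= _.
by case: (t o).
Qed.

(** Induction on the execution rather than on the program: the remaining rounds of a [While] are
    then covered by an induction hypothesis. *)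
Lemma exec_reach p st st' : exec p st st' -> (max_reg p <= K)%N ->
  forall t, represents t st -> exists2 t', represents t' st' &
    reach (@ctrl_step p) (Some (ctrl_start p)) t None t'.
Proof.
elim=> {p st st'} [st|st i b|st i|p q st1 st2 st3 _ IHp _ IHq|i p st sti|
  i p st1 st2 st3 sti _ IHp _ IHw|i p q st1 st2 sti _ IH|
  i p q st1 st2 sti _ IH] /=.
- move=> _ t rt; exists t => //.
  by apply: ReachStep; rewrite /= act_tapes_none; exact: ReachRefl.
- move=> iK t rt.
  eexists; last by do 2!(apply: ReachStep => /=); exact: ReachRefl.
  move=> o j; rewrite !act_tapes_on /upd; case: (val o =P i) => [oi|_]; last exact: rt.
  subst i; have := rt o; case: (t o) => l a r /=.
  by case: j => [//|j] /(_ j).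
- move=> iK t rt.
  eexists; last by apply: ReachStep => /=; exact: ReachRefl.
  move=> o j; rewrite !act_tapes_on /upd; case: (val o =P i) => [oi|_]; last exact: rt.
  subst i; have := rt o j.+1; case: (t o) => l a r /=.
  by case: r => [|c r]; case: (st _) => [|b s]; case: j => //= j; rewrite ?nth_nil.
- rewrite geq_max => /andP[pK qK] t rt.
  have [t2 rt2 h2] := IHp pK t rt; have [t3 rt3 h3] := IHq qK t2 rt2.
  exists t3 => //.
  apply: (@reach_trans _ _ _ _ (Some (inr (ctrl_start q))) t2).
    apply: (@reach_lift _ _ _ _ (fun o =>
      Some (if o is Some z then inl z else inr (ctrl_start q))) inl _ _ _ _ _ _ h2) => //.
    by move=> x h /=; case: ctrl_step.
  apply: (@reach_lift _ _ _ _ (fun o =>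
      if o is Some z then Some (inr z) else None) inr _ _ _ _ _ _ h3) => //.
  by move=> x h /=; case: ctrl_step.
- rewrite geq_max => /andP[iK _] t rt; exists t => //.
  apply: ReachStep; rewrite /= act_tapes_none /heads_of ffunE.
  by rewrite (represents_head _ rt) inordK // sti /=; exact: ReachRefl.
- rewrite geq_max => /andP[iK pK] t rt.
  have [t2 rt2 h2] := IHp pK t rt.
  have [|t3 rt3 h3] := IHw _ t2 rt2; first by rewrite geq_max iK.
  exists t3 => //; apply: reach_trans h3.
  apply: ReachStep; rewrite /= act_tapes_none /heads_of ffunE.
  rewrite (represents_head _ rt) inordK //.
  case: (st1 i) sti => //= b s _.
  apply: (@reach_lift _ _ _ _ (fun o => Some o) Some _ _ _ _ _ _ h2) => //.
  by move=> x h /=; case: ctrl_step.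
- rewrite !geq_max => /and3P[iK pK qK] t rt.
  have [t2 rt2 h2] := IH pK t rt; exists t2 => //.
  apply: ReachStep; rewrite /= act_tapes_none /heads_of ffunE.
  rewrite (represents_head _ rt) inordK //.
  case: (st1 i) sti => //= -[] // s _ /=.
  apply: (@reach_lift _ _ _ _ (fun o => if o is Some z then Some (Some (inl z))
    else None) (fun z => Some (inl z)) _ _ _ _ _ _ h2) => //.
  by move=> x h /=; case: ctrl_step.
- rewrite !geq_max => /and3P[iK pK qK] t rt.
  have [t2 rt2 h2] := IH qK t rt; exists t2 => //.
  apply: ReachStep; rewrite /= act_tapes_none /heads_of ffunE.
  rewrite (represents_head _ rt) inordK //.
  have -> : (if head None [seq Some (inl b) | b <- st1 i] is Some (inl true)
    then inl (ctrl_start p) else inr (ctrl_start q)) =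
    inr (ctrl_start q) :> ctrl p + ctrl q.
    by case: (st1 i) sti => //= -[].
  apply: (@reach_lift _ _ _ _ (fun o => if o is Some z then Some (Some (inr z))
    else None) (fun z => Some (inr z)) _ _ _ _ _ _ h2) => //.
  by move=> x h /=; case: ctrl_step.
Qed.

End Compile.

Definition prog_TM (p : prog) : TM :=
  @MkTM (max_reg p) (option (ctrl p)) void (Some (ctrl_start p))
    (fun q => ~~ isSome q)
    (fun q h => if q is Some x then ctrl_step x h else (None, act_none h)).

Definition input_store (x : seq bool) : store := fun j => if j == 0%N then x else [::].

Lemma reach_iter p o t t' : reach (@ctrl_step (max_reg p) p) o t None t' ->
  exists n, iter n (@tm_step (prog_TM p)) (@Config (prog_TM p) o t) =
            @Config (prog_TM p) None t'.
Proof.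
move oE : None => o'; move=> h; elim: h oE => [{}o {}t <-|x {}t {}o {}t' _ IH].
  by exists 0%N.
move=> /IH[n nE]; exists n.+1; rewrite iterSr -nE; congr (iter _ _ _).
by rewrite /tm_step /=; case: (ctrl_step _ _).
Qed.

Lemma exec_computes p x st :
  exec p (input_store x) st -> computes (prog_TM p) x (st 0%N).
Proof.
move=> /(@exec_reach (max_reg p))/(_ (leqnn _)).
move=> /(_ (fun i => input_tape void (if i == ord0 then x else [::])))[].
  move=> o j; rewrite /input_store /= (_ : (val o == 0%N) = (o == ord0)) //.
  by case: ifP => _; [case: x|]; rewrite //= nth_nil; case: j => [|[]].
move=> t rt /reach_iter[n nE]; exists n.
  by rewrite /tm_halts /tm_run /tm_init nE.
rewrite /tm_run /tm_init nE /= /tape_output.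
(* Cellwise agreement suffices: the blank after the last bit of the stack ends the output block. *)
have : forall (l : seq (option (bool + void))) s,
  (forall j, nth None l j = nth None [seq Some (inl b) | b <- s] j) ->
  leading_bits l = s.
  elim=> [|a l IH] [|b s] //=.
  - by move/(_ 0%N).
  - by move=> /(_ 0%N)/= ->.
  - by move=> h; have /= -> := h 0%N; rewrite (IH s) // => j; exact: (h j.+1).
by apply; exact: (rt ord0).
Qed.

(** * Functions computable with counters *)

Local Open Scope nat_scope.

(* [i] counts down, so that on a counter machine it is the remaining fuel. *)
Fixpoint loop (n : nat) (F : nat -> nat -> nat) (r : nat) : nat :=
  if n is i.+1 then loop i F (F i r) else r.

Definition unary n := nseq n true.

(* Registers from [k] on are free scratch space and are empty again at the
   end, except for the result in register [k]. *)
Definition register_computable (f : seq nat -> nat) : Prop :=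
  forall (l : seq nat) (k : nat), all (fun i => i < k) l ->
  exists c, forall st : store,
    (forall i, i \in l -> st i = unary (size (st i))) ->
    (forall j, k <= j -> st j = [::]) ->
    exec c st (upd st k (unary (f [seq size (st i) | i <- l]))).

Lemma upd_same st k s : upd st k s k = s.
Proof. by rewrite /upd eqxx. Qed.

Lemma upd_other st k s j : j != k -> upd st k s j = st j.
Proof. by rewrite /upd => /negbTE ->. Qed.

Lemma upd_id st k : upd st k (st k) = st.
Proof. by apply/funext => j; rewrite /upd; case: eqP => // ->. Qed.

Lemma size_unary n : size (unary n) = n.
Proof. exact: size_nseq. Qed.

Lemma unaryS_cat n s : unary n.+1 ++ s = unary n ++ true :: s.
Proof. by elim: n => //= n ->. Qed.

Definition clear i := While i (Pop i).

Lemma exec_clear i st : exec (clear i) st (upd st i [::]).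
Proof.
move sE : (st i) => s; elim: s st sE => [|b s IH] st sE.
  by rewrite -sE upd_id; exact: ExecWhileNil.
apply: (@ExecWhile _ _ _ (upd st i s)); rewrite ?sE //.
  by rewrite -[s]/(behead (b :: s)) -sE; exact: ExecPop.
have := IH (upd st i s); rewrite upd_same => /(_ erefl); congr exec.
by apply/funext => x; rewrite /upd; case: eqP.
Qed.

Definition move i j := While i (Seq (Pop i) (Push j true)).

Lemma exec_move i j st : i != j ->
  exec (move i j) st (upd (upd st i [::]) j (unary (size (st i)) ++ st j)).
Proof.
move=> ij; move sE : (st i) => s; elim: s st sE => [|b s IH] st sE.
  rewrite -sE upd_id sE /= upd_id; exact: ExecWhileNil.
apply: (@ExecWhile _ _ _ (upd (upd st i s) j (true :: st j))); rewrite ?sE //.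
  apply: ExecSeq; first exact: ExecPop.
  rewrite sE /= -[st j](@upd_other st i s) 1?eq_sym //; exact: ExecPush.
have := IH (upd (upd st i s) j (true :: st j)).
rewrite upd_other // !upd_same => /(_ erefl); congr exec.
rewrite (unaryS_cat (size s) (st j) : unary (size (b :: s)) ++ _ = _).
by apply/funext => x; rewrite /upd; case: eqP => // _; case: eqP.
Qed.

(** Reading a register destroys it, so [i] is drained into [j] and the scratch register [k] together
    and then restored from [k]. *)
Definition copy i j k :=
  Seq (While i (Seq (Pop i) (Seq (Push j true) (Push k true)))) (move k i).

Lemma exec_copy i j k st : i != j -> i != k -> j != k ->
  st i = unary (size (st i)) -> st k = [::] ->
  exec (copy i j k) st (upd st j (unary (size (st i)) ++ st j)).
Proof.
move=> ij ik jk sti stk.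
have loopE : forall n st, size (st i) = n ->
  exec (While i (Seq (Pop i) (Seq (Push j true) (Push k true)))) st
    (upd (upd (upd st i [::]) j (unary n ++ st j)) k (unary n ++ st k)).
  elim=> [|n IH] {sti stk} st sE.
    have st0 : st i = [::] by apply/nilP/eqP.
    by rewrite -st0 upd_id /= !upd_id; exact: ExecWhileNil.
  case stE : (st i) sE => [//|b s] [sE].
  pose st' := upd (upd (upd st i s) j (true :: st j)) k (true :: st k).
  apply: (@ExecWhile _ _ _ st'); first by rewrite stE.
    apply: ExecSeq; first exact: ExecPop.
    rewrite stE /= /st'; apply: (@ExecSeq _ _ _ (upd (upd st i s) j (true :: st j))).
      rewrite -[st j](@upd_other st i s) 1?eq_sym //; exact: ExecPush.
    have -> : st k = upd (upd st i s) j (true :: st j) k.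
      by rewrite !upd_other // eq_sym.
    exact: ExecPush.
  have st'i : st' i = s by rewrite /st' upd_other // upd_other // upd_same.
  have st'j : st' j = true :: st j by rewrite /st' upd_other // upd_same.
  have st'k : st' k = true :: st k by rewrite /st' upd_same.
  have := IH st'; rewrite st'i st'j st'k => /(_ sE); congr exec.
  rewrite -!unaryS_cat.
  by apply/funext => x; rewrite /st' /upd; do 2!case: eqP => // _; case: eqP.
apply: (ExecSeq (loopE _ _ erefl)).
set st1 := upd _ _ _; have := exec_move st1 (_ : k != i).
rewrite eq_sym => /(_ ik); congr exec.
apply/funext => x; rewrite /upd /st1 upd_same stk cats0 size_unary.
case: (x =P i) => [->|/eqP xi].
  by rewrite (negbTE ij) upd_other // upd_other // upd_same cats0 -sti.
case: (x =P k) => [->|/eqP xk]; first by rewrite eq_sym (negbTE jk).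
case: (x =P j) => [->|/eqP xj]; first by rewrite upd_other // upd_same.
by rewrite !upd_other.
Qed.

(** * Closure under variables, substitution and bounded recursion *)

Section Closure.
Implicit Types f g : seq nat -> nat.
Local Notation E := register_computable.

Lemma ext_computable f g : f =1 g -> E f -> E g.
Proof. by move=> /funext ->. Qed.

Lemma var_computable i : E (fun v => nth 0 v i).
Proof.
move=> l k lk; have [il|il] := ltnP i (size l); last first.
  exists Skip => st _ stk; rewrite nth_default ?size_map //.
  by have := ExecSkip st; rewrite -{2}(upd_id st k) stk.
have ril : nth 0 l i \in l by rewrite mem_nth.
have rk : nth 0 l i < k by apply: (allP lk).
exists (copy (nth 0 l i) k k.+1) => st stl stk.
rewrite (nth_map 0) //.
have := @exec_copy (nth 0 l i) k k.+1 st.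
rewrite (stk k (leqnn k)) cats0; apply; rewrite ?neq_ltn ?rk ?(ltnW rk) ?ltnSn //.
- by rewrite ltnS ltnW.
- exact: stl.
- by rewrite stk.
Qed.

Lemma zero_computable : E (fun=> 0).
Proof.
move=> l k _; exists Skip => st _ stk.
by have := ExecSkip st; rewrite -{2}(upd_id st k) stk.
Qed.

Lemma succ_computable f : E f -> E (fun v => (f v).+1).
Proof.
move=> Ef l k lk; have [c hc] := Ef l k lk; exists (Seq c (Push k true)).
move=> st stl stk; apply: (ExecSeq (hc st stl stk)).
set st1 := upd _ _ _; have := ExecPush st1 k true; congr exec.
rewrite {2}/st1 upd_same /st1.
by apply/funext => x; rewrite /upd; case: eqP.
Qed.

Lemma pred_computable f : E f -> E (fun v => (f v).-1).
Proof.
move=> Ef l k lk; have [c hc] := Ef l k lk; exists (Seq c (Pop k)).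
move=> st stl stk; apply: (ExecSeq (hc st stl stk)).
set st1 := upd _ _ _; have := ExecPop st1 k; congr exec.
rewrite {2}/st1 upd_same /st1; apply/funext => x; rewrite /upd; case: eqP => // _.
by case: (f _).
Qed.

Lemma weaken_computable f : E f -> E (fun v => f (behead v)).
Proof.
move=> Ef l k lk; have [|c hc] := Ef (behead l) k.
  by case: l lk => //= x l /andP[].
exists c => st stl stk; rewrite behead_map; apply: hc => // i il.
by apply: stl; case: l il {lk} => //= x l il; rewrite inE il orbT.
Qed.

Lemma size_upd_map st k s l : all (fun i => i < k) l ->
  [seq size (upd st k s i) | i <- l] = [seq size (st i) | i <- l].
Proof.
move=> /allP lk; apply/eq_in_map => i /lk ik.
by rewrite upd_other // neq_ltn ik.
Qed.

Lemma exec_replace k st m n : st k = unary m -> st k.+1 = unary n ->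
  exec (Seq (clear k) (move k.+1 k)) st (upd (upd st k.+1 [::]) k (unary n)).
Proof.
move=> stk stk1; apply: (ExecSeq (exec_clear _ _)).
have := @exec_move k.+1 k (upd st k [::]).
rewrite neq_ltn ltnSn orbT => /(_ isT); congr exec.
rewrite upd_same upd_other ?stk1 ?size_unary ?neq_ltn ?ltnSn ?orbT // cats0.
by apply/funext => x; rewrite /upd; case: eqP.
Qed.

(** Environments work like de Bruijn contexts: register [k] holding the value of [f] becomes
    variable 0 for [g], whose scratch space starts one register later. *)
Lemma let_computable f g : E f -> E g -> E (fun v => g (f v :: v)).
Proof.
move=> Ef Eg l k lk; have [cf hf] := Ef l k lk.
have lk1 : all (fun i => i < k.+1) (k :: l).
  by rewrite /= ltnSn; apply: sub_all lk => i /ltnW.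
have [cg hg] := Eg (k :: l) k.+1 lk1.
exists (Seq cf (Seq cg (Seq (clear k) (move k.+1 k)))) => st stl stk.
apply: (ExecSeq (hf st stl stk)).
set v := [seq _ | _ <- _]; set st1 := upd _ _ _.
have {}hg := hg st1.
rewrite [[seq _ | _ <- _]](_ : _ = f v :: v) in hg; last first.
  by rewrite /= /st1 size_upd_map // upd_same size_unary.
apply: (ExecSeq (hg _ _)) => [i|j kj|].
- rewrite inE => /orP[/eqP->|il]; rewrite /st1.
    by rewrite upd_same size_unary.
  by rewrite upd_other; [exact: stl | rewrite neq_ltn (allP lk)].
- by rewrite /st1 upd_other ?stk ?(ltnW kj) // neq_ltn kj orbT.
set st2 := upd _ _ _.
have := @exec_replace k st2 (f v) (g (f v :: v)).
have st1k : st1 k = unary (f v) by rewrite /st1 upd_same.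
rewrite /st2 upd_same upd_other ?neq_ltn ?ltnSn // st1k.
move=> /(_ erefl erefl); congr exec.
apply/funext => x; rewrite /st1 /upd; case: eqP => // xk.
by case: eqP => // ->; rewrite stk.
Qed.

(** Register [k] holds the counter, [k.+1] the accumulator, and the body delivers its value in
    [k.+2]. Popping before the body runs makes the counter equal to the index that the body
    expects. *)
Lemma loop_computable n z b : E n -> E z -> E b ->
  E (fun v => loop (n v) (fun i r => b (r :: i :: v)) (z v)).
Proof.
move=> En Ez Eb l k lk; have [cn hn] := En l k lk.
have lk1 : all (fun i => i < k.+1) l by apply: sub_all lk => i /ltnW.
have lk2 : all (fun i => i < k.+2) (k.+1 :: k :: l).
  by rewrite /= !ltnS leqnn leqnSn /=; apply: sub_all lk1 => i /ltnW.
have [cz hz] := Ez l k.+1 lk1; have [cb hb] := Eb _ _ lk2.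
pose body := Seq (Pop k) (Seq cb (Seq (clear k.+1) (move k.+2 k.+1))).
exists (Seq cn (Seq cz (Seq (While k body) (move k.+1 k)))) => st stl stk.
have nk1 : k != k.+1 by rewrite neq_ltn ltnSn.
have nk2 : k.+1 != k by rewrite neq_ltn ltnSn orbT.
pose st2 i r := upd (upd st k (unary i)) k.+1 (unary r).
have st2l i r j : j \in l -> st2 i r j = st j.
  move=> jl; rewrite /st2 !upd_other // neq_ltn.
    by rewrite (allP lk).
  by rewrite (allP lk1).
apply: (ExecSeq (hn st stl stk)); set v := [seq _ | _ <- _].
apply: (@ExecSeq _ _ _ (st2 (n v) (z v))).
  rewrite /st2; set st1 := upd st k _.
  have := hz st1; rewrite [[seq size (st1 _) | _ <- _]]size_upd_map //.
  apply=> [i il|j kj].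
    by rewrite /st1 upd_other; [exact: stl | rewrite neq_ltn (allP lk)].
  by rewrite /st1 upd_other ?stk ?(ltnW kj) // neq_ltn kj orbT.
have loopE m r : exec (While k body) (st2 m r)
    (st2 0 (loop m (fun i r => b (r :: i :: v)) r)).
  elim: m r => [|m IH] r /=.
    by apply: ExecWhileNil; rewrite /st2 upd_other // upd_same.
  apply: ExecWhile (IH _); first by rewrite /st2 upd_other // upd_same.
  apply: (@ExecSeq _ _ _ (st2 m r)).
    have := ExecPop (st2 m.+1 r) k; congr exec.
    rewrite {2}/st2 upd_other // upd_same /= /st2.
    by apply/funext => x; rewrite /upd; case: eqP => // ->; rewrite (negbTE nk1).
  apply: (@ExecSeq _ _ _ (upd (st2 m r) k.+2 (unary (b (r :: m :: v))))).
    have vE : [seq size (st2 m r i) | i <- k.+1 :: k :: l] = r :: m :: v.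
      rewrite /= /st2 upd_same upd_other // upd_same !size_unary.
      congr [:: _, _ & _]; apply/eq_in_map => i il.
      by rewrite -(st2l m r i il).
    rewrite -vE; apply: hb => [i|j kj].
      rewrite !inE => /or3P[/eqP->|/eqP->|il].
      - by rewrite /st2 upd_same size_unary.
      - by rewrite /st2 upd_other // upd_same size_unary.
      - by rewrite st2l //; exact: stl.
    rewrite /st2 !upd_other ?stk // ?(ltnW (ltnW kj)) // ?neq_ltn ?kj ?orbT //.
    by rewrite (ltnW kj) orbT.
  set r' := b (r :: m :: v).
  have := @exec_replace k.+1 (upd (st2 m r) k.+2 (unary r')) r r'.
  rewrite upd_same upd_other; last by rewrite neq_ltn ltnSn.
  rewrite /st2 upd_same => /(_ erefl erefl); congr exec.
  apply/funext => x; rewrite /upd; case: eqP => // _; case: eqP => // ->.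
  by rewrite gtn_eqF ?stk // ltnW.
apply: (ExecSeq (loopE _ _)).
have := exec_move (st2 0 (loop (n v) (fun i r => b (r :: i :: v)) (z v))) nk2.
congr exec; apply/funext => x; rewrite /st2 upd_same /upd (negbTE nk1) eqxx.
rewrite size_unary cats0; case: eqP => // _; case: eqP => // ->.
by rewrite stk.
Qed.
End Closure.

(** * Arithmetic, pairing and finite tables from bounded recursion *)

Section Arithmetic.
Local Notation E := register_computable.

Lemma loop_env_computable n z (B : nat -> nat -> seq nat -> nat) :
  E n -> E z ->
  E (fun w => B (nth 0 w 1) (nth 0 w 0) (behead (behead w))) ->
  E (fun v => loop (n v) (fun i r => B i r v) (z v)).
Proof. by move=> En Ez EB; have := loop_computable En Ez EB. Qed.

Lemma const_computable c : E (fun=> c).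
Proof.
by elim: c => [|c IH]; [exact: zero_computable | exact: succ_computable].
Qed.

(** Closed under substitution by definition, so that it applies directly as a rule inside larger
    terms. *)
Definition computable1 (f : nat -> nat) := forall a, E a -> E (fun v => f (a v)).

Definition computable2 (f : nat -> nat -> nat) :=
  forall a b, E a -> E b -> E (fun v => f (a v) (b v)).

Lemma computable1P f : E (fun v => f (nth 0 v 0)) -> computable1 f.
Proof. by move=> Ef a Ea; have := let_computable Ea Ef. Qed.

Lemma addn_computable a b : E a -> E b -> E (fun v => a v + b v).
Proof.
move=> Ea Eb.
apply: (@ext_computable (fun v => loop (b v) (fun _ r => r.+1) (a v))).
  by move=> v; elim: (b v) (a v) => [|n IH] m /=; rewrite ?addn0 // IH addSnnS.
apply: (@loop_env_computable _ _ (fun _ r _ => r.+1)) => //.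
exact/succ_computable/var_computable.
Qed.

Lemma subn_computable a b : E a -> E b -> E (fun v => a v - b v).
Proof.
move=> Ea Eb.
apply: (@ext_computable (fun v => loop (b v) (fun _ r => r.-1) (a v))).
  move=> v; elim: (b v) (a v) => [|n IH] m /=; rewrite ?subn0 // IH.
  by rewrite -subn1 -subnDA add1n.
apply: (@loop_env_computable _ _ (fun _ r _ => r.-1)) => //.
exact/pred_computable/var_computable.
Qed.

Lemma sum_computable n (F : nat -> seq nat -> nat) : E n ->
  E (fun w => F (nth 0 w 0) (behead w)) ->
  E (fun v => \sum_(i < n v) F i v).
Proof.
move=> En EF.
apply: (@ext_computable (fun v => loop (n v) (fun i r => r + F i v) 0)).
  move=> v; suff loopE m r :
      loop m (fun i r => r + F i v) r = r + \sum_(i < m) F i v by exact: loopE.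
  elim: m r => [|m IH] r /=; first by rewrite big_ord0 addn0.
  by rewrite IH big_ord_recr /= -addnA [F m v + _]addnC.
apply: (@loop_env_computable _ _ (fun i r v => r + F i v)) => //.
  exact: zero_computable.
apply: addn_computable; first exact: var_computable.
apply: ext_computable (weaken_computable EF) => w /=.
by rewrite nth_behead.
Qed.

Lemma muln_computable a b : E a -> E b -> E (fun v => a v * b v).
Proof.
move=> Ea Eb; apply: (@ext_computable (fun v => \sum_(i < b v) a v)).
  by move=> v; rewrite sum_nat_const card_ord mulnC.
by apply: (@sum_computable _ (fun _ v => a v)) => //; exact: weaken_computable.
Qed.

Lemma expn_computable a b : E a -> E b -> E (fun v => a v ^ b v).
Proof.
move=> Ea Eb.
apply: (@ext_computable (fun v => loop (b v) (fun _ r => r * a v) 1)).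
  move=> v; suff loopE n m : loop n (fun _ r => r * a v) m = m * a v ^ n.
    by rewrite loopE mul1n.
  elim: n m => [|n IH] m /=; first by rewrite muln1.
  by rewrite IH expnS mulnA.
apply: (@loop_env_computable _ _ (fun _ r v => r * a v)) => //.
  exact: const_computable.
apply: muln_computable; first exact: var_computable.
exact: weaken_computable (weaken_computable Ea).
Qed.

Lemma eq0_computable a : E a -> E (fun v => a v == 0).
Proof.
move=> Ea; apply: (@ext_computable (fun v => 1 - a v)).
  by move=> v; case: (a v).
exact: subn_computable (const_computable 1) Ea.
Qed.

Lemma leq_computable a b : E a -> E b -> E (fun v => a v <= b v).
Proof. by move=> Ea Eb; exact/eq0_computable/subn_computable. Qed.

Lemma ltn_computable a b : E a -> E b -> E (fun v => a v < b v).
Proof. by move=> Ea Eb; exact/leq_computable/Eb/succ_computable. Qed.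

Lemma andb_computable (p q : seq nat -> bool) :
  E p -> E q -> E (fun v => p v && q v).
Proof.
move=> Ep Eq; apply: (@ext_computable (fun v => p v * q v)).
  by move=> v; rewrite mulnb.
exact: muln_computable.
Qed.

Lemma negb_computable (p : seq nat -> bool) : E p -> E (fun v => ~~ p v).
Proof.
move=> Ep; apply: (@ext_computable (fun v => p v == 0 :> nat)).
  by move=> v; case: (p v).
exact: eq0_computable.
Qed.

Lemma eqn_computable a b : E a -> E b -> E (fun v => a v == b v :> nat).
Proof.
move=> Ea Eb.
apply: (@ext_computable (fun v => (a v <= b v) && (b v <= a v))).
  by move=> v; rewrite eqn_leq.
by apply: andb_computable; exact: leq_computable.
Qed.

Lemma if_computable (p : seq nat -> bool) a b :
  E p -> E a -> E b -> E (fun v => if p v then a v else b v).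
Proof.
move=> Ep Ea Eb.
apply: (@ext_computable (fun v => p v * a v + (~~ p v) * b v)).
  by move=> v; case: (p v); rewrite !(mul1n, mul0n, addn0).
apply: addn_computable; apply: muln_computable => //; exact: negb_computable.
Qed.

Lemma has_computable n (p : nat -> seq nat -> bool) : E n ->
  E (fun w => p (nth 0 w 0) (behead w)) ->
  E (fun v => [exists i : 'I_(n v), p i v]).
Proof.
move=> En Ep; apply: (@ext_computable
    (fun v => ~~ (\sum_(i < n v) p i v == 0))).
  move=> v; congr (nat_of_bool _); rewrite sum_nat_eq0 negb_forall.
  by apply: eq_existsb => i; rewrite eqb0 negbK.
apply/negb_computable/eq0_computable.
exact: (@sum_computable _ (fun i v => p i v)).
Qed.

(* The least hit, since [loop] counts down; 0 if there is none. *)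
Definition search n (p : nat -> bool) := loop n (fun i r => if p i then i else r) 0.

Lemma search_uniq n (p : nat -> bool) i : i < n -> p i -> (forall j, p j -> j = i) ->
  search n p = i.
Proof.
move=> i_n pi uniq; rewrite /search.
have : forall r, i < n \/ r = i ->
    loop n (fun i r => if p i then i else r) r = i.
  elim: n {i_n} => [|n IH] r /= [] // h.
  - apply: IH; case: ifP => [/uniq->|npn]; first by right.
    left; move: h; rewrite ltnS leq_eqVlt => /orP[/eqP iE|//].
    by rewrite iE npn in pi.
  - by apply: IH; right; case: ifP => // /uniq.
by apply; left.
Qed.

Lemma search_none n (p : nat -> bool) : (forall j, p j = false) -> search n p = 0.
Proof. by move=> np; rewrite /search; elim: n => //= n; rewrite np. Qed.

Lemma search_computable n (p : nat -> seq nat -> bool) : E n ->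
  E (fun w => p (nth 0 w 0) (behead w)) ->
  E (fun v => search (n v) (p^~ v)).
Proof.
move=> En Ep.
apply: (@loop_env_computable _ _ (fun i r v => if p i v then i else r)) => //.
  exact: zero_computable.
apply: if_computable; last 2 first. 1,2: exact: var_computable.
apply: ext_computable (weaken_computable Ep) => w /=.
by rewrite nth_behead.
Qed.

Lemma divn_computable a d : E a -> E d -> E (fun v => a v %/ d v).
Proof.
move=> Ea Ed.
apply: (@ext_computable (fun v => search (a v).+1
    (fun i => (i * d v <= a v) && (a v < i.+1 * d v)))).
  (* For divisor 0 no candidate passes, and the default 0 of [search] is the conventional
     quotient. *)
  move=> v; case: (posnP (d v)) => [->|d0].
    by rewrite divn0; apply: search_none => j; rewrite !muln0 andbF.
  apply: search_uniq; first by rewrite ltnS leq_div.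
    by rewrite leq_divM -ltn_divLR ?ltnSn.
  move=> j; rewrite -leq_divRL // -ltn_divLR // ltnS => h.
  by apply/eqP; rewrite eqn_leq.
apply: (@search_computable _ (fun i v => (i * d v <= a v) && (a v < i.+1 * d v))).
  exact: succ_computable.
apply: andb_computable.
  apply: leq_computable; last exact: weaken_computable.
  by apply: muln_computable; [exact: var_computable | exact: weaken_computable].
apply: ltn_computable; first exact: weaken_computable.
apply: muln_computable; last exact: weaken_computable.
exact/succ_computable/var_computable.
Qed.

Lemma modn_computable a d : E a -> E d -> E (fun v => a v %% d v).
Proof.
move=> Ea Ed; apply: (@ext_computable (fun v => a v - a v %/ d v * d v)).
  by move=> v; rewrite {1}(divn_eq (a v) (d v)) addKn.
by apply: subn_computable => //; apply: muln_computable => //; exact: divn_computable.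
Qed.

Lemma trunc_log_computable a : E a -> E (fun v => trunc_log 2 (a v).+1).
Proof.
move=> Ea; apply: (@ext_computable (fun v => search (a v).+1
    (fun i => (2 ^ i <= (a v).+1) && ((a v).+1 < 2 ^ i.+1)))).
  move=> v; apply: search_uniq.
  - rewrite -(ltn_exp2l _ _ (ltnSn 1)).
    by rewrite (leq_ltn_trans (trunc_logP _ _)) // ltn_expl.
  - by have /= -> := @trunc_log_bounds 2 (a v).+1 isT isT.
  - by move=> j /trunc_log_eq->.
apply: (@search_computable _ (fun i v => (2 ^ i <= (a v).+1) && ((a v).+1 < 2 ^ i.+1))).
  exact: succ_computable.
apply: andb_computable.
  apply: leq_computable; last exact/succ_computable/weaken_computable.
  by apply: expn_computable; [exact: const_computable | exact: var_computable].
apply: ltn_computable; first exact/succ_computable/weaken_computable.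
apply: expn_computable; first exact: const_computable.
exact/succ_computable/var_computable.
Qed.

(** Injective because [a] is at most [a + b], which keeps the value below the next square.
    Components are recovered by bounded search, without square roots. *)
Definition npair a b := (a + b) ^ 2 + a.

Lemma npair_inj a b a' b' : npair a b = npair a' b' -> a = a' /\ b = b'.
Proof.
rewrite /npair => h.
have sE : a + b = a' + b'.
  apply/eqP; rewrite eqn_leq; apply/andP; split; rewrite leqNgt; apply/negP => lt.
  - move: lt; rewrite -(leq_sqr (_.+1)) => lt.
    have : (a' + b').+1 ^ 2 <= (a' + b') ^ 2 + a'.
      by rewrite -h (leq_trans lt) // leq_addr.
    by rewrite -!mulnn; nia.
  - move: lt; rewrite -(leq_sqr (_.+1)) => lt.
    have : (a + b).+1 ^ 2 <= (a + b) ^ 2 + a.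
      by rewrite h (leq_trans lt) // leq_addr.
    by rewrite -!mulnn; nia.
have aE : a = a' by move: h; rewrite sE => /addnI.
by split=> //; move: sE; rewrite aE => /addnI.
Qed.

Lemma leq_npairl a b : a <= npair a b.
Proof. exact: leq_addl. Qed.

Lemma leq_npairr a b : b <= npair a b.
Proof.
apply: leq_trans (leq_addr _ _); rewrite -mulnn.
by case: (posnP (a + b)) => h; nia.
Qed.

Definition nfst n := search n.+1 (fun i => [exists j : 'I_n.+1, npair i j == n]).
Definition nsnd n := search n.+1 (fun j => [exists i : 'I_n.+1, npair i j == n]).

Lemma npairK1 a b : nfst (npair a b) = a.
Proof.
apply: search_uniq; first by rewrite ltnS leq_npairl.
  have lb : b < (npair a b).+1 by rewrite ltnS leq_npairr.
  by apply/existsP; exists (Ordinal lb).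
by move=> i /existsP[j /eqP/npair_inj[]].
Qed.

Lemma npairK2 a b : nsnd (npair a b) = b.
Proof.
apply: search_uniq; first by rewrite ltnS leq_npairr.
  have la : a < (npair a b).+1 by rewrite ltnS leq_npairl.
  by apply/existsP; exists (Ordinal la).
by move=> i /existsP[j /eqP/npair_inj[]].
Qed.

Lemma npair_computable a b : E a -> E b -> E (fun v => npair (a v) (b v)).
Proof.
move=> Ea Eb; apply: addn_computable => //.
by apply: expn_computable; [exact: addn_computable | exact: const_computable].
Qed.

Lemma nfst_computable : computable1 nfst.
Proof.
apply: computable1P; have V i : E (fun v => nth 0 v i) := var_computable i.
apply: (@search_computable _ (fun i v =>
  [exists j : 'I_(nth 0 v 0).+1, npair i j == nth 0 v 0])).
  exact: succ_computable.
apply: (@has_computable (fun w => (nth 0 (behead w) 0).+1) (fun j w =>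
  npair (nth 0 w 0) j == nth 0 (behead w) 0)).
  exact: succ_computable (weaken_computable (V 0)).
apply: eqn_computable; last exact: weaken_computable (weaken_computable (V 0)).
by apply: npair_computable; first exact: weaken_computable (V 0).
Qed.

Lemma nsnd_computable : computable1 nsnd.
Proof.
apply: computable1P; have V i : E (fun v => nth 0 v i) := var_computable i.
apply: (@search_computable _ (fun j v =>
  [exists i : 'I_(nth 0 v 0).+1, npair i j == nth 0 v 0])).
  exact: succ_computable.
apply: (@has_computable (fun w => (nth 0 (behead w) 0).+1) (fun i w =>
  npair i (nth 0 w 0) == nth 0 (behead w) 0)).
  exact: succ_computable (weaken_computable (V 0)).
apply: eqn_computable; last exact: weaken_computable (weaken_computable (V 0)).
by apply: npair_computable; last exact: weaken_computable (V 0).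
Qed.

Lemma iter_computable n z g : E n -> E z -> computable1 g ->
  E (fun v => iter (n v) g (z v)).
Proof.
move=> En Ez Eg.
apply: (@ext_computable (fun v => loop (n v) (fun _ r => g r) (z v))).
  by move=> v; elim: (n v) (z v) => //= m IH r; rewrite IH -iterSr.
apply: (@loop_env_computable _ _ (fun _ r _ => g r)) => //.
exact/Eg/var_computable.
Qed.

(** A finite table is a nest of conditionals over [enum F]. This is what makes the arbitrary
    transition function of a machine arithmetical. *)
Lemma table_computable (F : finType) (key res : F -> nat) : injective key ->
  exists2 g, computable1 g & forall x, g (key x) = res x.
Proof.
move=> key_inj.
exists (fun n => foldr (fun x r => if n == key x then res x else r) 0 (enum F)).
  apply: computable1P; elim: (enum F) => /= [|x s IH].
    exact: const_computable.
  apply: if_computable => //; last exact: const_computable.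
  by apply: eqn_computable; [exact: var_computable | exact: const_computable].
move=> x; have : x \in enum F by rewrite mem_enum.
elim: (enum F) => //= y s IH; rewrite inE (inj_eq key_inj).
by case: eqP => [->|].
Qed.

Definition vec (s : seq nat) := foldr npair 0 s.
Definition vec_nth n i := nfst (iter i nsnd n).

Lemma vec_nthE s i : i < size s -> vec_nth (vec s) i = nth 0 s i.
Proof.
rewrite /vec_nth; elim: s i => // x s IH [|i] /=; first by rewrite npairK1.
by rewrite ltnS => /IH <-; rewrite -iterS iterSr /= npairK2.
Qed.

Lemma vec_nth_computable i a : E a -> E (fun v => vec_nth (a v) i).
Proof.
move=> Ea; apply: nfst_computable.
by elim: i => //= i IH; exact: nsnd_computable.
Qed.

Lemma vec_computable (I : Type) (s : seq I) (F : I -> seq nat -> nat) :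
  (forall i, E (F i)) -> E (fun v => vec [seq F i v | i <- s]).
Proof.
move=> EF; elim: s => /= [|i s IH]; first exact: const_computable.
exact: npair_computable.
Qed.

End Arithmetic.

(** * Numbering of bit strings and unbounded search *)

(* Bijective base 2. *)
Definition code (x : seq bool) : nat :=
  foldl (fun n (b : bool) => (n.*2 + b).+1) 0 x.

Lemma code_rcons x b : code (rcons x b) = ((code x).*2 + b).+1.
Proof. by rewrite /code foldl_rcons. Qed.

Lemma code_inj : injective code.
Proof.
move=> x; elim/last_ind: x => [|x b IH] y; case/lastP: y => [|y c] //;
  rewrite ?code_rcons //.
case=> h; have bc : b = c by move: h; case: b; case: c => //; lia.
by rewrite bc in h *; rewrite (IH y) //; lia.
Qed.

Lemma code_surj n : exists x, code x = n.
Proof.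
elim/ltn_ind: n => -[|n] IH; first by exists [::].
have [|x xn] := IH n./2; first by lia.
by exists (rcons x (odd n)); rewrite code_rcons xn; lia.
Qed.

Lemma code_bounds x : 2 ^ size x <= (code x).+1 < 2 ^ (size x).+1.
Proof.
elim/last_ind: x => // x b; rewrite code_rcons size_rcons !expnS.
by case: b; lia.
Qed.

Lemma trunc_log_code x : trunc_log 2 (code x).+1 = size x.
Proof. exact/trunc_log_eq/code_bounds. Qed.

Lemma code_bin_value x : (code x).+1 = bin_value x + 2 ^ size x.
Proof.
elim/last_ind: x => // x b; rewrite code_rcons size_rcons.
rewrite /bin_value foldl_rcons -/(bin_value x) expnS.
by case: b; lia.
Qed.

(** Layout of the search program: 0 is the input and later the output string, 1 the code of the
    input, 2 the candidate, 3 the test flag and later the code of the output. *)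
Definition regs (s : seq bool) (a b c : nat) : store :=
  fun j => match j with
    0 => s | 1 => unary a | 2 => unary b | 3 => unary c | _ => [::] end.

Ltac regs_eq := by apply/funext => -[|[|[|[|?]]]].

Lemma regs_upd0 s a b c s' : upd (regs s a b c) 0 s' = regs s' a b c.
Proof. regs_eq. Qed.

Definition assign k c := Seq c (Seq (clear k) (move k.+1 k)).

Lemma exec_assign k st m c : st k = unary (size (st k)) -> st k.+1 = [::] ->
  exec c st (upd st k.+1 (unary m)) ->
  exec (assign k c) st (upd st k (unary m)).
Proof.
move=> stk stk1 h; apply: (ExecSeq h).
have := @exec_replace k (upd st k.+1 (unary m)) (size (st k)) m.
rewrite upd_same upd_other ?neq_ltn ?ltnSn // => /(_ stk erefl); congr exec.
apply/funext => x; rewrite /upd; case: eqP => // _.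
by case: eqP => // ->.
Qed.

Section SearchMachine.
Variables P g : nat -> nat -> nat.
Hypotheses (P_comp : computable2 P) (g_comp : computable2 g).

Lemma search_prog : exists c, forall x n, 0 < P (code x) n ->
  (forall m, m < n -> P (code x) m = 0) ->
  forall y, code y = g (code x) n ->
  exec c (input_store x) (regs y (code x) n 0).
Proof.
have V := var_computable.
have [c0 h0] := succ_computable (addn_computable (V 0) (V 0))
  (isT : all (fun i => i < 2) [:: 1]).
have [c1 h1] := succ_computable (succ_computable (addn_computable (V 0) (V 0)))
  (isT : all (fun i => i < 2) [:: 1]).
have [cp hp] := eq0_computable (P_comp (V 0) (V 1)) (isT : all (fun i => i < 3) [:: 1; 2]).
have [cg hg] := g_comp (V 0) (V 1) (isT : all (fun i => i < 3) [:: 1; 2]).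
have [co ho] := modn_computable (pred_computable (V 0)) (const_computable 2)
  (isT : all (fun i => i < 4) [:: 3]).
have [ch hh] := divn_computable (pred_computable (V 0)) (const_computable 2)
  (isT : all (fun i => i < 4) [:: 3]).
pose read := While 0 (Seq (If 0 (assign 1 c1) (assign 1 c0)) (Pop 0)).
(* Register 3 holds the truth value of [P = 0], so the loop runs exactly while the candidate
   fails. *)
pose find := Seq cp (While 3 (Seq (Seq (clear 3) (Push 2 true)) cp)).
pose write := While 3 (Seq (Seq co (If 4 (Push 0 true) (Push 0 false)))
                           (Seq (clear 4) (assign 3 ch))).
exists (Seq read (Seq find (Seq cg write))) => x n Pn Pm y gE.
have readE x1 x2 : exec read (regs x2 (code x1) 0 0) (regs [::] (code (x1 ++ x2)) 0 0).
  elim: x2 x1 => [|b x2 IH] x1; first by rewrite cats0; exact: ExecWhileNil.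
  apply: ExecWhile => //; last by rewrite -cat_rcons; exact: IH.
  apply: (@ExecSeq _ _ _ (regs (b :: x2) (code (rcons x1 b)) 0 0)); last first.
    by have := ExecPop (regs (b :: x2) (code (rcons x1 b)) 0 0) 0; rewrite regs_upd0.
  have -> : regs (b :: x2) (code (rcons x1 b)) 0 0 =
    upd (regs (b :: x2) (code x1) 0 0) 1 (unary (code (rcons x1 b))) by regs_eq.
  case: b; [apply: ExecIfT => //|apply: ExecIfF => //].
    apply: exec_assign; rewrite /= ?size_unary //.
    have := h1 (regs (true :: x2) (code x1) 0 0).
    rewrite /= size_unary code_rcons addn1 addnn; apply => [i|j].
      by rewrite inE => /eqP->; rewrite /= size_unary.
    by case: j => [|[|[|[|]]]].
  apply: exec_assign; rewrite /= ?size_unary //.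
  have := h0 (regs (false :: x2) (code x1) 0 0).
  rewrite /= size_unary code_rcons addn0 addnn; apply => [i|j].
    by rewrite inE => /eqP->; rewrite /= size_unary.
  by case: j => [|[|[|[|]]]].
apply: (@ExecSeq _ _ _ (regs [::] (code x) 0 0)).
  have := readE [::] x; congr exec; apply/funext => -[|[|[|[|?]]]] //.
have cpE k : exec cp (regs [::] (code x) k 0) (regs [::] (code x) k (P (code x) k == 0)).
  have := hp (regs [::] (code x) k 0).
  rewrite /= !size_unary.
  have -> : upd (regs [::] (code x) k 0) 3 (unary (P (code x) k == 0)) =
    regs [::] (code x) k (P (code x) k == 0) by regs_eq.
  apply => [i|j].
    by rewrite !inE => /orP[]/eqP->; rewrite /= size_unary.
  by case: j => [|[|[|[|]]]].
have findE k : k <= n -> exec (While 3 (Seq (Seq (clear 3) (Push 2 true)) cp))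
    (regs [::] (code x) k (P (code x) k == 0)) (regs [::] (code x) n 0).
  move=> kn; move dE : (n - k) => d; elim: d k kn dE => [|d IH] k kn dE.
    have -> : k = n by lia.
    by rewrite eqn0Ngt Pn; exact: ExecWhileNil.
  have kn' : k < n by lia.
  rewrite (Pm k) //; apply: ExecWhile (IH k.+1 kn' _) => //; last by lia.
  apply: ExecSeq (cpE _).
  apply: (@ExecSeq _ _ _ (regs [::] (code x) k 0)).
    by have := exec_clear 3 (regs [::] (code x) k true); congr exec; regs_eq.
  by have := ExecPush (regs [::] (code x) k 0) 2 true; congr exec; regs_eq.
apply: (@ExecSeq _ _ _ (regs [::] (code x) n 0)).
  exact: ExecSeq (cpE 0) (findE 0 (leq0n n)).
apply: (@ExecSeq _ _ _ (regs [::] (code x) n (code y))).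
  have := hg (regs [::] (code x) n 0); rewrite /= !size_unary -gE.
  have -> : upd (regs [::] (code x) n 0) 3 (unary (code y)) =
    regs [::] (code x) n (code y) by regs_eq.
  apply => [i|j].
    by rewrite !inE => /orP[]/eqP->; rewrite /= size_unary.
  by case: j => [|[|[|[|]]]].
(* Bijective base 2 gives up its last bit first, and pushing restores the order; [y2] is the part
   already written. *)
suff writeE y1 y2 : exec write (regs y2 (code x) n (code y1)) (regs (y1 ++ y2) (code x) n 0).
  by have := writeE y [::]; rewrite cats0.
elim/last_ind: y1 y2 {gE} => [|y1 b IH] y2; first exact: ExecWhileNil.
rewrite cat_rcons; apply: ExecWhile (IH (b :: y2)); first by rewrite code_rcons.
have bE : (code (rcons y1 b)).-1 %% 2 = b.
  by rewrite code_rcons modn2 /= oddD odd_double oddb.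
have hE : (code (rcons y1 b)).-1 %/ 2 = code y1.
  by rewrite code_rcons divn2 /= addnC half_bit_double.
pose st := regs y2 (code x) n (code (rcons y1 b)).
have st4 s : upd (upd st 4 (unary s)) 4 [::] = st.
  by apply/funext => -[|[|[|[|[|?]]]]].
have stu i : i \in [:: 3] -> st i = unary (size (st i)).
  by rewrite inE => /eqP->; rewrite /= size_unary.
have stn j : 4 <= j -> st j = [::] by case: j => [|[|[|[|]]]].
pose st' := regs (b :: y2) (code x) n (code (rcons y1 b)).
apply: (@ExecSeq _ _ _ (upd st' 4 (unary b))).
  apply: (@ExecSeq _ _ _ (upd st 4 (unary b))).
    by have := ho st stu stn; rewrite /= size_unary bE.
  have pushE c d : exec (Push 0 c) (upd st 4 (unary d))
      (upd (regs (c :: y2) (code x) n (code (rcons y1 b))) 4 (unary d)).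
    have := ExecPush (upd st 4 (unary d)) 0 c; congr exec.
    by apply/funext => -[|[|[|[|[|?]]]]].
  suff bitE (d : bool) : exec (If 4 (Push 0 true) (Push 0 false))
      (upd st 4 (unary d))
      (upd (regs (d :: y2) (code x) n (code (rcons y1 b))) 4 (unary d)).
    exact: bitE.
  by case: d; [apply: ExecIfT => //|apply: ExecIfF => //]; exact: pushE.
apply: (@ExecSeq _ _ _ st').
  have := exec_clear 4 (upd st' 4 (unary b)); congr exec.
  by apply/funext => -[|[|[|[|[|?]]]]].
have -> : regs (b :: y2) (code x) n (code y1) = upd st' 3 (unary (code y1)) by regs_eq.
apply: exec_assign => //; first by rewrite /= size_unary.
have := hh st'; rewrite /= size_unary hE; apply => [i|j].
  by rewrite inE => /eqP->; rewrite /= size_unary.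
by case: j => [|[|[|[|]]]].
Qed.

(** The hit [m] is the least one and may differ from [n]. A user must therefore show that every
    value passing the test is good. *)
Lemma search_TM : exists C, forall x n, 0 < P (code x) n ->
  exists2 m, 0 < P (code x) m &
    exists2 y, code y = g (code x) m & computes C x y.
Proof.
have [c hc] := search_prog; exists (prog_TM c) => x n Pn.
have exP : exists m, 0 < P (code x) m by exists n.
case: (ex_minnP exP) => m Pm min_m.
have [y yE] := code_surj (g (code x) m); exists m => //; exists y => //.
apply: (@exec_computes c x (regs y (code x) m 0)); apply: hc => // k km.
by apply/eqP; rewrite eqn0Ngt; apply/negP => /min_m; rewrite leqNgt km.
Qed.
End SearchMachine.

(** * Simulation of a Turing machine by arithmetic *)

Section Simulation.
Local Notation E := register_computable.

Section Tape.
Variable A : finType.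
Local Notation sym := (option (bool + A)).

(** The bits get the values 1 and 2, the digits of bijective base 2, so that translating between
    [code] and tape contents only moves digits. *)
Definition sym_code (a : sym) : nat :=
  match a with
  | None => 0
  | Some (inl b) => b.+1
  | Some (inr x) => (enum_rank x).+3
  end.

Definition base := #|A|.+3.

Lemma sym_code_lt a : sym_code a < base.
Proof. by case: a => [[[]|x]|]; rewrite /base //= !ltnS. Qed.

Lemma sym_code_inj : injective sym_code.
Proof.
move=> [[b|x]|] [[c|y]|] //=.
- by case: b; case: c.
- by case: b.
- by case: c.
- by case=> /ord_inj/enum_rank_inj ->.
Qed.

(* Blank is the digit 0, so that appending blanks does not change the code. *)
Definition cells_code (s : seq sym) : nat :=
  foldr (fun a n => sym_code a + base * n) 0 s.

Lemma cells_code_mod s : cells_code s %% base = sym_code (head None s).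
Proof.
by case: s => //= a s; rewrite mulnC addnC modnMDl modn_small ?sym_code_lt.
Qed.

Lemma cells_code_div s : cells_code s %/ base = cells_code (behead s).
Proof.
case: s => //= a s.
by rewrite mulnC addnC divnMDl // divn_small ?addn0 ?sym_code_lt.
Qed.

Definition tape_code (t : tape (bool + A)) : nat :=
  npair (cells_code (tape_left t))
        (npair (sym_code (tape_head t)) (cells_code (tape_right t))).

Definition dir_code (d : dir) : nat :=
  match d with MoveL => 0 | Stay => 1 | MoveR => 2 end.

Definition tape_code_step (t a d : nat) : nat :=
  let l := nfst t in let r := nsnd (nsnd t) in
  if d == 0 then npair (l %/ base) (npair (l %% base) (a + base * r))
  else if d == 1 then npair l (npair a r)
  else npair (a + base * l) (npair (r %% base) (r %/ base)).

Lemma tape_code_stepE t a d :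
  tape_code_step (tape_code t) (sym_code a) (dir_code d) =
  tape_code (tape_move d (tape_write a t)).
Proof.
case: t => l b r; rewrite /tape_code_step /tape_code /= !npairK2 !npairK1.
by case: d; rewrite /= ?cells_code_mod ?cells_code_div.
Qed.

Lemma tape_code_step_computable t a d : E t -> E a -> E d ->
  E (fun v => tape_code_step (t v) (a v) (d v)).
Proof.
move=> Et Ea Ed; have C := const_computable.
have El := nfst_computable Et; have Er := nsnd_computable (nsnd_computable Et).
apply: if_computable; first exact: eq0_computable.
  apply: npair_computable; first exact: divn_computable.
  apply: npair_computable; first exact: modn_computable.
  by apply: addn_computable => //; exact: muln_computable.
apply: if_computable; first exact: eqn_computable.
  by apply: npair_computable => //; exact: npair_computable.
apply: npair_computable.
  by apply: addn_computable => //; exact: muln_computable.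
by apply: npair_computable; [exact: modn_computable | exact: divn_computable].
Qed.

(** Moves the last digit of the string to the front of the tape contents. An exhausted string is a
    fixed point, so the code itself is a sufficient number of iterations. *)
Definition read_step (n : nat) : nat :=
  let c := nfst n in
  if c == 0 then n
  else npair (c.-1 %/ 2) ((c.-1 %% 2).+1 + base * nsnd n).

Lemma read_stepE x n : code x <= n ->
  iter n read_step (npair (code x) 0) =
  npair 0 (cells_code [seq Some (inl b) | b <- x]).
Proof.
suff readE m x1 x2 : code x1 <= m ->
    iter m read_step (npair (code x1) (cells_code [seq Some (inl b) | b <- x2])) =
    npair 0 (cells_code [seq Some (inl b) | b <- x1 ++ x2]).
  by move=> xn; have := readE n x [::] xn; rewrite cats0.
elim: m x1 x2 => [|m IH] x1 x2; case/lastP: x1 => [|x1 b].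
- by [].
- by rewrite code_rcons.
- move=> _; apply: etrans (IH [::] x2 isT); rewrite iterSr; congr (iter m read_step _).
  by rewrite /read_step npairK1.
rewrite code_rcons ltnS => h.
rewrite cat_rcons; apply: etrans (IH x1 (b :: x2) _); last first.
  by apply: leq_trans h; lia.
rewrite iterSr; congr (iter m read_step _); rewrite /read_step npairK1 npairK2 /=.
rewrite modn2 oddD odd_double oddb divn2 addnC half_bit_double.
by [].
Qed.

Lemma read_step_computable : computable1 read_step.
Proof.
move=> a Ea; have C := const_computable; have Ec := nfst_computable Ea.
apply: if_computable; [exact: eq0_computable | exact: Ea |].
have Ep := pred_computable Ec.
apply: npair_computable; first exact: divn_computable.
apply: addn_computable; first by apply: succ_computable; exact: modn_computable.
by apply: muln_computable => //; exact: nsnd_computable.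
Qed.

(** The converse transfer. It stays put at the first digit that is not a bit, which is where the
    output block ends. *)
Definition write_step (n : nat) : nat :=
  let a := nfst n %% base in
  if (0 < a) && (a < 3) then npair (nfst n %/ base) (2 * nsnd n + a) else n.

Lemma write_stepE s n : size (leading_bits s) <= n ->
  nsnd (iter n write_step (npair (cells_code s) 0)) = code (leading_bits s).
Proof.
suff writeE m t y : size (leading_bits t) <= m ->
    nsnd (iter m write_step (npair (cells_code t) (code y))) =
    code (y ++ leading_bits t).
  by move=> /(writeE n s [::]).
elim: m t y => [|m IH] t y.
  by rewrite leqn0 => /nilP->; rewrite cats0 npairK2.
case lE : (leading_bits t) => [|b l] lm.
  have : write_step (npair (cells_code t) (code y)) = npair (cells_code t) (code y).
    rewrite /write_step npairK1 cells_code_mod.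
    by case: t lE => [|[[c|x]|] t].
  by move=> fixE; rewrite iterSr fixE IH lE.
case: t lE => [|[[c|x]|] t] // lE; rewrite iterSr.
have [cb {}lE] : c :: leading_bits t = b :: l by [].
rewrite -cb -cat_rcons -lE; apply: etrans (IH t (rcons y c) _); last by rewrite lE.
congr (nsnd (iter m write_step _)).
rewrite /write_step npairK1 npairK2 cells_code_mod cells_code_div /=.
by case: c {cb}; rewrite /= code_rcons; congr npair; lia.
Qed.

Lemma size_leading_bits (s : seq sym) : size (leading_bits s) <= cells_code s.
Proof.
elim: s => //= -[[b|x]|] s IH //=.
apply: (@leq_trans (1 + cells_code s)); first by rewrite add1n ltnS.
by rewrite leq_add // leq_pmull.
Qed.

Lemma write_step_computable : computable1 write_step.
Proof.
move=> n En; have C := const_computable.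
have El := nfst_computable En.
have Ea := modn_computable El (C base).
apply: if_computable => //.
  by apply: andb_computable; exact: ltn_computable.
apply: npair_computable; first exact: divn_computable.
apply: addn_computable => //; apply: muln_computable => //.
exact: nsnd_computable.
Qed.

End Tape.

(** * Configurations and bounded runs *)

Variable M : TM.
Local Notation I := 'I_(tm_tapes M).+1.
Let heads := {ffun I -> option (bool + tm_aux M)}.

Definition config_code (c : config M) : nat :=
  npair (enum_rank (cf_state c))
        (vec [seq tape_code (cf_tapes c i) | i <- enum I]).

Definition scan_code (x : tm_state M * heads) : nat :=
  npair (enum_rank x.1) (vec [seq sym_code (x.2 i) | i <- enum I]).

Lemma vec_nth_enum (F : I -> nat) (i : I) : vec_nth (vec [seq F i | i <- enum I]) i = F i.
Proof.
have iI : i < size (enum I) by rewrite size_enum_ord ltn_ord.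
rewrite vec_nthE; last by rewrite size_map; exact: iI.
apply: (etrans (@nth_map _ i _ 0 F i (enum I) iI)).
by rewrite nth_ord_enum.
Qed.

Lemma scan_code_inj : injective scan_code.
Proof.
move=> [q h] [q' h'] /npair_inj[/ord_inj/enum_rank_inj/= -> hE].
congr pair; apply/ffunP => i; apply: sym_code_inj.
rewrite -[LHS](vec_nth_enum (fun i => sym_code (h i))) hE.
exact: (vec_nth_enum (fun i => sym_code (h' i))).
Qed.

(** A step depends only on the state and the scanned symbols, which form a finite type. Hence two
    tables suffice: [go] for halting and the next state, [ga] for the action on each tape. *)
Lemma config_step_computable :
  exists2 g, computable1 g & forall c, g (config_code c) = config_code (tm_step c).
Proof.
pose act (x : tm_state M * heads) := (tm_delta x.1 x.2).2.
have [go go_comp goE] := table_computable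
  (fun x : tm_state M * heads => npair (tm_halt x.1) (enum_rank (tm_delta x.1 x.2).1))
  scan_code_inj.
have iscan_inj : injective (fun x : I * (tm_state M * heads) => npair x.1 (scan_code x.2)).
  by move=> [i x] [j y] /npair_inj[/ord_inj/= -> /scan_code_inj ->].
have [ga ga_comp gaE] := table_computable
  (fun x : I * (tm_state M * heads) =>
     npair (sym_code (act x.2 x.1).1) (dir_code (act x.2 x.1).2)) iscan_inj.
pose scan n := npair (nfst n)
  (vec [seq nfst (nsnd (vec_nth (nsnd n) (i : I))) | i <- enum I]).
exists (fun n => if nfst (go (scan n)) == 1 then n else
  npair (nsnd (go (scan n))) (vec [seq tape_code_step (tm_aux M) (vec_nth (nsnd n) (i : I))
    (nfst (ga (npair i (scan n)))) (nsnd (ga (npair i (scan n)))) | i <- enum I])).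
  move=> a Ea; have C := const_computable.
  have Et := nsnd_computable Ea.
  have Es : E (fun v => scan (a v)).
    apply: npair_computable; first exact: nfst_computable.
    apply: (@vec_computable _ _ (fun (i : I) v => nfst (nsnd (vec_nth (nsnd (a v)) i)))).
    by move=> i; apply/nfst_computable/nsnd_computable/vec_nth_computable.
  have Eg := go_comp _ Es.
  apply: if_computable => //.
    by apply: eqn_computable => //; exact: nfst_computable.
  apply: npair_computable; first exact: nsnd_computable.
  apply: (@vec_computable _ _ (fun (i : I) v => tape_code_step (tm_aux M)
    (vec_nth (nsnd (a v)) (i : I))
    (nfst (ga (npair i (scan (a v))))) (nsnd (ga (npair i (scan (a v))))))) => i.
  have Ei : E (fun v => ga (npair i (scan (a v)))).
    by apply: ga_comp; exact: npair_computable.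
  apply: tape_code_step_computable.
  - exact: vec_nth_computable.
  - exact: nfst_computable.
  - exact: nsnd_computable.
move=> c; pose h : heads := [ffun i => tape_head (cf_tapes c i)].
have tE i : vec_nth (nsnd (config_code c)) (i : I) = tape_code (cf_tapes c i).
  by rewrite /config_code npairK2 (vec_nth_enum (fun i => tape_code (cf_tapes c i))).
have -> : scan (config_code c) = scan_code (cf_state c, h).
  rewrite /scan /scan_code {1}/config_code npairK1; congr (npair _ (vec _)).
  apply: eq_map => i; rewrite tE /tape_code npairK2 npairK1 /h ffunE.
  by [].
rewrite goE npairK1 npairK2 /= /tm_step eqb1.
case: ifP => // _; rewrite -/h /config_code.
case dE : (tm_delta _ _) => [q a] /=; congr (npair _ (vec _)).
apply: eq_map => i; rewrite -/(config_code c) tE.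
have /= -> := gaE (i, (cf_state c, h)).
by rewrite npairK1 npairK2 tape_code_stepE /act /= dE.
Qed.

Lemma config_init_computable :
  exists2 g, computable1 g & forall x, g (code x) = config_code (tm_init M x).
Proof.
pose A := tm_aux M.
pose cells n := nsnd (iter n (read_step A) (npair n 0)).
have cells_comp : computable1 cells.
  move=> a Ea; apply: nsnd_computable.
  apply: (@iter_computable _ (fun v => npair (a v) 0)) => //; last exact: read_step_computable.
  exact: npair_computable (const_computable 0).
exists (fun n => npair (enum_rank (tm_start M)) (vec [seq
  (if i == ord0 :> I then npair 0 (npair (cells n %% base A) (cells n %/ base A))
   else npair 0 (npair 0 0)) | i <- enum I])).
  move=> a Ea; have C := const_computable.
  apply: npair_computable => //.
  apply: (@vec_computable _ _ (fun (i : I) v => if i == ord0 :> I then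
    npair 0 (npair (cells (a v) %% base A) (cells (a v) %/ base A))
    else npair 0 (npair 0 0))) => i; case: (i == ord0) => //.
  apply: npair_computable => //; have Ec := cells_comp _ Ea.
  by apply: npair_computable; [exact: modn_computable | exact: divn_computable].
move=> x; rewrite /config_code /=; congr (npair _ (vec _)).
apply: eq_map => i; case: ifP => _ //.
rewrite /cells read_stepE // npairK2 cells_code_mod cells_code_div.
by [].
Qed.

(* Bounded simulation: 0 stands for "not halted yet". *)
Definition bounded_output (x : seq bool) (n : nat) : nat :=
  if tm_halts M x n then (code (tape_output (cf_tapes (tm_run M x n) ord0))).+1
  else 0.

Lemma simulation_computable : exists2 g, computable2 g &
  forall x n, g (code x) n = bounded_output x n.
Proof.
have [gi gi_comp giE] := config_init_computable.
have [gs gs_comp gsE] := config_step_computable.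
have rank_inj : injective (fun q : tm_state M => nat_of_ord (enum_rank q)).
  by move=> p q /ord_inj/enum_rank_inj.
have [gh gh_comp ghE] := table_computable
  (fun q : tm_state M => nat_of_bool (tm_halt q)) rank_inj.
pose A := tm_aux M.
pose out n := let t := nsnd (vec_nth (nsnd n) 0) in
  nfst t + base A * nsnd t.
(* The code of the scanned tape half bounds the length of its block of bits, so it doubles as the
   number of write steps. *)
exists (fun a n => let c := iter n gs (gi a) in
  if gh (nfst c) == 1 then
    (nsnd (iter (out c) (write_step A) (npair (out c) 0))).+1 else 0).
  move=> a b Ea Eb; have C := const_computable.
  have Ec : E (fun v => iter (b v) gs (gi (a v))).
    by apply: (@iter_computable _ (fun v => gi (a v))) => //; exact: gi_comp.
  have Eo : E (fun v => out (iter (b v) gs (gi (a v)))).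
    have Et : E (fun v => nsnd (vec_nth (nsnd (iter (b v) gs (gi (a v)))) 0)).
      by apply/nsnd_computable/vec_nth_computable/nsnd_computable.
    apply: addn_computable; first exact: nfst_computable.
    by apply: muln_computable => //; exact: nsnd_computable.
  apply: if_computable => //.
    by apply: eqn_computable => //; apply: gh_comp; exact: nfst_computable.
  apply/succ_computable/nsnd_computable.
  apply: (@iter_computable _ (fun v => npair (out (iter (b v) gs (gi (a v)))) 0)) => //.
    exact: npair_computable.
  exact: write_step_computable.
move=> x n; have -> : iter n gs (gi (code x)) = config_code (tm_run M x n).
  by rewrite giE /tm_run; elim: n => //= n ->; rewrite gsE.
rewrite /bounded_output /tm_halts; set c := tm_run M x n.
rewrite {1}/config_code npairK1 ghE eqb1; case: ifP => // _; congr _.+1.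
have -> : out (config_code c) =
    cells_code (tape_head (cf_tapes c ord0) :: tape_right (cf_tapes c ord0)).
  rewrite /out /config_code npairK2.
  rewrite (vec_nth_enum (fun i => tape_code (cf_tapes c i)) ord0).
  by rewrite /tape_code !npairK2 npairK1.
by rewrite write_stepE // size_leading_bits.
Qed.

Lemma tm_run_halted x n m : tm_halts M x n -> n <= m -> tm_run M x m = tm_run M x n.
Proof.
move=> hn /subnK <-; elim: (m - n) => // d IH.
by rewrite addSn /tm_run iterS -/(tm_run M x _) IH /tm_step -/(tm_halts M x n) hn.
Qed.

Lemma bounded_output_gt0 x n : (0 < bounded_output x n) = tm_halts M x n.
Proof. by rewrite /bounded_output; case: ifP. Qed.

Lemma tm_halts_mono x n m : n <= m -> tm_halts M x n -> tm_halts M x m.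
Proof. by move=> nm hn; rewrite /tm_halts (tm_run_halted hn nm). Qed.

Lemma computes_bounded_output x y n :
  computes M x y -> tm_halts M x n -> bounded_output x n = (code y).+1.
Proof.
move=> [m hm <-] hn; rewrite /bounded_output hn; congr (code (tape_output _)).+1.
have hm' := tm_run_halted hm (leq_maxl m n).
by rewrite -(tm_run_halted hn (leq_maxr m n)) hm'.
Qed.

End Simulation.

Local Open Scope classical_set_scope.
Local Open Scope ring_scope.

(** * The sum over the domain and unending expansions *)

Section Weights.
Variables (R : realType) (lam : R).
Hypotheses (lam_gt0 : 0 < lam) (lam_lt : 2 * lam < 1).

(** The strings of length n have the codes from 2^n - 1 to 2^(n+1) - 2, so this is the geometric
    series in [2 * lam]. Over all strings the normalised weights thus sum to 1. *)
Lemma sum_trunc_log_weight N :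
  (1 - 2 * lam) * (\sum_(0 <= c < (2 ^ N).-1) lam ^+ trunc_log 2 c.+1) =
  1 - (2 * lam) ^+ N.
Proof.
elim: N => [|N IH]; first by rewrite big_geq // mulr0 expr0 subrr.
have N2 : (0 < 2 ^ N)%N by rewrite expn_gt0.
rewrite (@big_cat_nat _ _ _ (2 ^ N).-1) /= ?expnS; [|lia|lia].
rewrite mulrDr IH (eq_big_nat _ _ (F2 := fun=> lam ^+ N)); last first.
  by move=> c cN; congr (_ ^+ _); apply: trunc_log_eq => //; rewrite expnS; lia.
rewrite big_const_nat iter_addr_0.
have -> : ((2 * 2 ^ N).-1 - (2 ^ N).-1 = 2 ^ N)%N by lia.
by rewrite -[lam ^+ N *+ _]mulr_natl natrX exprS exprMn; ring.
Qed.

Lemma sum_weight_le1 (A : seq (seq bool)) : uniq A ->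
  (1 - 2 * lam) * (\sum_(p <- A) lam ^+ size p) <= 1.
Proof.
move=> Au; pose F c := lam ^+ trunc_log 2 c.+1.
have -> : \sum_(p <- A) lam ^+ size p = \sum_(c <- [seq code p | p <- A]) F c.
  by rewrite big_map; apply: eq_bigr => p _; rewrite /F trunc_log_code.
set s := map _ _; have su : uniq s by rewrite map_inj_uniq //; exact: code_inj.
have [N sN] : exists N, forall c, c \in s -> (c < (2 ^ N).-1)%N.
  exists (\max_(c <- s) c).+2 => c cs.
  have cm : (c <= \max_(c <- s) c)%N by exact: leq_bigmax_seq.
  have := ltn_expl (\max_(c <- s) c).+2 (isT : 1 < 2)%N; lia.
apply: (@le_trans _ _ (1 - (2 * lam) ^+ N)); last first.
  by rewrite gerBl exprn_ge0 // mulr_ge0 // ltW.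
rewrite -sum_trunc_log_weight ler_pM2l; last by rewrite subr_gt0.
have -> : \sum_(c <- s) F c = \sum_(0 <= c < (2 ^ N).-1 | c \in s) F c.
  rewrite -[RHS]big_filter; apply: perm_big; apply: uniq_perm => //.
    by rewrite filter_uniq ?iota_uniq.
  move=> c; rewrite mem_filter mem_index_iota /=.
  by case cs: (c \in s) => //; rewrite sN.
rewrite big_mkcond; apply: ler_sum => c _; case: ifP => // _.
by rewrite exprn_ge0 // ltW.
Qed.

End Weights.

Section Kappa.
Variables (R : realType) (T : TM) (s : R).
Hypothesis s_gt1 : 1 < s.

Definition lambda : R := 2 `^ (- s).

Lemma lambda_gt0 : 0 < lambda.
Proof. by rewrite powR_gt0. Qed.

Lemma powR2_neg1 : 2 `^ (- 1) = 2^-1 :> R.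
Proof. by rewrite powRN powRr1. Qed.

Lemma lambda_lt : 2 * lambda < 1.
Proof.
rewrite -ltr_pdivlMl // mulr1 -powR2_neg1 /lambda.
rewrite lt_neqAle ler_powR ?ler1n ?lerN2 ?ltW // andbT.
(* Strictness: equal powers have equal logarithms, which would force s = 1. *)
apply/negP => /eqP /(congr1 (@ln R)); rewrite !ln_powR.
move=> /mulIf; rewrite gt_eqF ?ln_gt0 ?ltr1n // => /(_ isT) /oppr_inj sE.
by move: s_gt1; rewrite sE ltxx.
Qed.

Lemma powR_lambda n : 2 `^ (- s * n%:R) = lambda ^+ n.
Proof. by rewrite powRrM powR_mulrn // powR_ge0. Qed.

Lemma kappa_def : kappa T s = (1 - 2 * lambda) *
  fine (\esum_(p in tm_dom T) (lambda ^+ size p)%:E)%E.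
Proof.
rewrite /kappa; congr ((1 - _) * fine _).
  by rewrite powRD ?pnatr_eq0 ?implybT // powRr1 // mulrC.
by apply: eq_esum => p _; rewrite powR_lambda.
Qed.

Let W := (\esum_(p in tm_dom T) (lambda ^+ size p)%:E)%E.

Lemma sum_le_W (A : seq (seq bool)) : uniq A ->
  (forall p, p \in A -> tm_dom T p) ->
  ((\sum_(p <- A) lambda ^+ size p)%:E <= W)%E.
Proof.
move=> Au AD; apply: esum_ge; exists [set` A].
  by split; [exact: finite_seq | move=> p /AD].
by rewrite -fsbig_seq // sumEFin.
Qed.

Lemma fsets_seq (X : set (seq bool)) : fsets (tm_dom T) X ->
  exists A, [/\ uniq A, forall p, p \in A -> tm_dom T p &
    (\sum_(p \in X) (lambda ^+ size p)%:E)%E = (\sum_(p <- A) lambda ^+ size p)%:E].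
Proof.
move=> [finX XD]; exists (finmap.enum_fset (fset_set X)); split.
- exact: finmap.fset_uniq.
- by move=> p; rewrite in_fset_set // inE => /XD.
- by rewrite fsbig_finite // sumEFin.
Qed.

(** An infinite sum would be cast to 0 by [fine]. Finite subsums are bounded by the inverse of the
    normalising factor. *)
Lemma W_fin_num : W \is a fin_num.
Proof.
have W0 : (0 <= W)%E.
  by apply: esum_ge0 => p _; rewrite lee_fin exprn_ge0 // ltW // lambda_gt0.
rewrite ge0_fin_numE //; apply: (@le_lt_trans _ _ ((1 - 2 * lambda)^-1)%:E); last exact: ltry.
apply: ge_ereal_sup => _ [X /fsets_seq[A [Au _ AE]] <-]; rewrite AE lee_fin.
rewrite -[leRHS]mul1r ler_pdivlMr ?subr_gt0 ?lambda_lt // mulrC.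
by apply: sum_weight_le1 => //; [exact: lambda_gt0 | exact: lambda_lt].
Qed.

Lemma sum_le_kappa (A : seq (seq bool)) : uniq A ->
  (forall p, p \in A -> tm_dom T p) ->
  (1 - 2 * lambda) * (\sum_(p <- A) lambda ^+ size p) <= kappa T s.
Proof.
move=> Au AD; rewrite kappa_def ler_pM2l ?subr_gt0 ?lambda_lt //.
by rewrite -lee_fin fineK ?W_fin_num //; exact: sum_le_W.
Qed.

Lemma lt_kappa_sum x : x < kappa T s -> exists A : seq (seq bool),
  [/\ uniq A, forall p, p \in A -> tm_dom T p &
      x < (1 - 2 * lambda) * (\sum_(p <- A) lambda ^+ size p)].
Proof.
have l1 : 0 < 1 - 2 * lambda by rewrite subr_gt0 lambda_lt.
rewrite kappa_def mulrC -ltr_pdivrMr // -lte_fin fineK ?W_fin_num //.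
move=> /ereal_sup_gt[_ [X /fsets_seq[A [Au AD AE]] <-]].
by rewrite AE lte_fin ltr_pdivrMr // mulrC => xA; exists A.
Qed.

Lemma kappa_le x : (forall A : seq (seq bool), uniq A ->
    (forall p, p \in A -> tm_dom T p) ->
    (1 - 2 * lambda) * (\sum_(p <- A) lambda ^+ size p) <= x) ->
  kappa T s <= x.
Proof.
move=> Ax; rewrite leNgt; apply/negP => /lt_kappa_sum[A [Au AD]].
by rewrite ltNge Ax.
Qed.

End Kappa.

(** * Binary digits of a real in the unit interval *)

Section Expansion.
Variable R : realType.

Lemma exp2_small (eps : R) : 0 < eps ->
  exists N, forall n, (N <= n)%N -> (2 ^+ n)^-1 < eps.
Proof.
move=> eps0; exists (Num.bound eps^-1) => n Nn.
rewrite invf_plt ?posrE ?exprn_gt0 //.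
have e0 : 0 <= eps^-1 by rewrite invr_ge0 ltW.
apply: lt_le_trans (archi_boundP e0) _.
rewrite -natrX ler_nat (leq_trans Nn) // ltnW // ltn_expl //.
Qed.

(** The ceiling minus one, not the floor: at dyadic points this choice gives the unending
    expansion. *)
Lemma exists_ceil (x : R) : 0 < x -> exists k : nat, k%:R < x <= k.+1%:R.
Proof.
move=> x0; have ex : exists n : nat, x <= n%:R.
  by exists (Num.bound x); rewrite ltW // archi_boundP // ltW.
case: (ex_minnP ex) => -[|n] hn min_n; first by move: hn; rewrite leNgt x0.
by exists n; rewrite hn andbT ltNge; apply/negP => /min_n; rewrite ltnn.
Qed.

(** The strict lower bound is what later lets a finite part of the sum exceed the truncated
    expansion; the upper bound limits what is left. *)
Lemma unending_expansion_exists (a : R) : 0 < a < 1 ->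
  exists2 b, unending_expansion a b & forall m,
    (bin_value (mkseq b m))%:R < a * 2 ^+ m <= (bin_value (mkseq b m)).+1%:R.
Proof.
move=> /andP[a0 a1].
have P2 n : 0 < 2 ^+ n :> R by rewrite exprn_gt0.
have /choice[k kP] : forall m, exists k : nat, k%:R < a * 2 ^+ m <= k.+1%:R.
  by move=> m; apply: exists_ceil; rewrite mulr_gt0.
have k0 : k 0%N = 0%N.
  have /andP[h _] := kP 0%N; move: h; rewrite expr0 mulr1 => h.
  by have := lt_trans h a1; rewrite -[1]/(1%:R) ltr_nat; case: (k 0%N).
(* The bounds leave only twice [k i] and its successor, which parity tells apart. *)
have kS i : k i.+1 = ((k i).*2 + odd (k i.+1))%N.
  have /andP[h1 h2] := kP i; have /andP[h3 h4] := kP i.+1.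
  rewrite exprS mulrCA in h3 h4.
  have : (k i).*2%:R < (k i.+1).+1%:R :> R.
    by apply: lt_le_trans h4; rewrite -muln2 natrM mulrC ltr_pM2l.
  have : (k i.+1)%:R < (k i).*2.+2%:R :> R.
    by apply: lt_le_trans h3 _; rewrite -doubleS -muln2 natrM mulrC ler_pM2r.
  rewrite !ltr_nat; lia.
pose b i := odd (k i.+1).
have kE m : bin_value (mkseq b m) = k m.
  elim: m => [|m IH]; first by rewrite k0.
  by rewrite mkseqS /bin_value foldl_rcons -/(bin_value _) IH [RHS]kS.
exists b; last by move=> m; rewrite kE.
have sumE n : \sum_(0 <= i < n) (b i)%:R / 2 ^+ i.+1 = (k n)%:R / 2 ^+ n :> R.
  elim: n => [|n IH]; first by rewrite big_geq // k0 mul0r.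
  rewrite big_nat_recr //= IH [in RHS]kS natrD mulrDl; congr (_ + _).
  by rewrite -muln2 natrM exprS; field.
have dist n : 0 < a - (k n)%:R / 2 ^+ n <= (2 ^+ n)^-1.
  have /andP[h1 h2] := kP n; apply/andP; split.
    by rewrite subr_gt0 ltr_pdivrMr.
  by rewrite lerBlDl -[X in _ + X]mul1r -mulrDl ler_pdivlMr // natr1.
split.
  (* With zeros from [N] on, the truncations would stop at a fixed positive distance from [a],
     although that distance is at most 2^-n. *)
  move=> N; apply: contrapT => noone.
  have b0 i : (N <= i)%N -> b i = false.
    by move=> Ni; apply/negP => bi; apply: noone; exists i.
  have kd d : (k (N + d)%N)%:R / 2 ^+ (N + d)%N = (k N)%:R / 2 ^+ N :> R.
    elim: d => [|d IH]; first by rewrite addn0.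
    rewrite -IH addnS kS -/(b _) b0 ?leq_addr // addn0.
    by rewrite -muln2 natrM exprS; field.
  have /andP[d0 _] := dist N.
  have [n0 hn0] := exp2_small d0.
  have := hn0 (N + n0)%N (leq_addl _ _); rewrite ltNge => /negP; apply.
  by have /andP[_] := dist (N + n0)%N; rewrite kd.
apply/cvgrPdist_lt => eps eps0; have [N hN] := exp2_small eps0.
exists N => // n /= Nn; rewrite sumE.
have /andP[h1 h2] := dist n; rewrite gtr0_norm //.
exact: le_lt_trans h2 (hN n Nn).
Qed.

End Expansion.

(** * Rational bounds for 2^-s *)

Section Approximation.
Variable R : realType.

(** From exp(y) >= 1 + y and ln 2 <= 1. It measures how much a small shift of the exponent costs. *)
Lemma powR2N_ge (x : R) : 0 <= x -> 1 - x <= 2 `^ (- x).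
Proof.
move=> x0; rewrite /powR pnatr_eq0 /=.
apply: le_trans (expR_ge1Dx _); rewrite lerD2l mulNr lerN2 ler_piMr //.
have -> : 2 = 1 + 1 :> R by [].
by apply: le_ln1Dx; rewrite (lt_trans (ltrN10 R)) ?ltr01.
Qed.

Lemma expr_powR2 j c : (2 `^ (- (c%:R / 2 ^+ j))) ^+ (2 ^ j) = (2 ^+ c)^-1 :> R.
Proof.
rewrite -powR_mulrn ?powR_ge0 // -powRrM natrX mulNr divfK ?expf_neq0 ?pnatr_eq0 //.
by rewrite powRN powR_mulrn.
Qed.

(** Raising both sides to the power 2^j turns a comparison with an irrational root into one of
    integers. *)
Lemma rational_root_le t e j c :
  (t ^ (2 ^ j) * 2 ^ c <= 2 ^ (e * 2 ^ j))%N =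
  (t%:R / 2 ^+ e <= 2 `^ (- (c%:R / 2 ^+ j)) :> R).
Proof.
have P2 n : 0 < 2 ^+ n :> R by rewrite exprn_gt0.
have x0 : 0 <= t%:R / 2 ^+ e :> R by rewrite divr_ge0 // ltW.
rewrite -[RHS](@ler_pXn2r _ (2 ^ j)%N) ?expn_gt0 ?nnegrE ?powR_ge0 //.
rewrite expr_powR2 exprMn exprVn -exprM ler_pdivrMr // mulrC ler_pdivlMr //.
by rewrite -(ler_nat R) natrM !natrX.
Qed.

Lemma rational_root_ge t e j c :
  (2 ^ (e * 2 ^ j) <= t ^ (2 ^ j) * 2 ^ c)%N =
  (2 `^ (- (c%:R / 2 ^+ j)) <= t%:R / 2 ^+ e :> R).
Proof.
have P2 n : 0 < 2 ^+ n :> R by rewrite exprn_gt0.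
have x0 : 0 <= t%:R / 2 ^+ e :> R by rewrite divr_ge0 // ltW.
rewrite -[RHS](@ler_pXn2r _ (2 ^ j)%N) ?expn_gt0 ?nnegrE ?powR_ge0 //.
rewrite expr_powR2 exprMn exprVn -exprM ler_pdivlMr // mulrC ler_pdivrMr //.
by rewrite -(ler_nat R) natrM !natrX.
Qed.

(** If a/2^j is within 2^-j of s, the exponents a+1 and a-1 absorb the error on either side. *)
Definition brackets (t e j a : nat) : bool :=
  ((t ^ (2 ^ j) * 2 ^ a.+1 <= 2 ^ (e * 2 ^ j)) &&
   (2 ^ (e * 2 ^ j) <= (t + 2) ^ (2 ^ j) * 2 ^ a.-1))%N.

Variable s : R.
Hypothesis s_gt1 : 1 < s.
Let lam := lambda s.

Lemma brackets_sound t e j a : (0 < a)%N -> `|s - a%:R / 2 ^+ j| <= (2 ^+ j)^-1 ->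
  brackets t e j a -> t%:R / 2 ^+ e <= lam <= (t + 2)%:R / 2 ^+ e.
Proof.
move=> a0; rewrite ler_norml => /andP[h1 h2].
rewrite /brackets rational_root_le rational_root_ge => /andP[tl tr].
apply/andP; split.
  apply: le_trans tl _; rewrite ler_powR ?ler1n // lerN2.
  by rewrite -natr1 mulrDl mul1r; lra.
apply: le_trans tr; rewrite ler_powR ?ler1n // lerN2.
by rewrite -subn1 natrB // mulrBl mul1r; lra.
Qed.

(** The precision [j] comes before [a], since the numerator is whatever the machine for s outputs.
    Strict inequalities leave room for the exponent to be off by twice 2^-j. *)
Lemma brackets_complete t e : t%:R / 2 ^+ e < lam -> lam < (t + 2)%:R / 2 ^+ e ->
  exists j, forall a, (0 < a)%N -> `|s - a%:R / 2 ^+ j| <= (2 ^+ j)^-1 ->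
  brackets t e j a.
Proof.
set x := t%:R / _; set y := (t + 2)%:R / _ => xl ly.
have l0 : 0 < lam by exact: lambda_gt0.
have y0 : 0 < y by exact: lt_trans ly.
(* With d = 2^-j the two thresholds say x < lam (1 - 2d) and lam < y (1 - 2d). *)
have [j1 hj1] := @exp2_small _ ((lam - x) / lam / 2) ltac:(by rewrite !divr_gt0 // subr_gt0).
have [j2 hj2] := @exp2_small _ ((y - lam) / y / 2) ltac:(by rewrite !divr_gt0 // subr_gt0).
exists (maxn j1 j2) => a a0; rewrite ler_norml => /andP[h1 h2].
move: (hj1 _ (leq_maxl j1 j2)) (hj2 _ (leq_maxr j1 j2)) h1 h2.
set j := maxn j1 j2; set d := (2 ^+ j)^-1 => {hj1 hj2}.
have d0 : 0 < d by rewrite invr_gt0 exprn_gt0.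
rewrite ltr_pdivlMr // ltr_pdivlMr // => d1.
rewrite ltr_pdivlMr // ltr_pdivlMr // => d2 h1 h2.
have dE : 2 `^ (- (2 * d)) >= 1 - 2 * d by apply: powR2N_ge; lra.
have p0 : 2 != 0 :> R by rewrite pnatr_eq0.
rewrite /brackets rational_root_le rational_root_ge -/x -/y; apply/andP; split.
  apply: (@le_trans _ _ (2 `^ (- s + - (2 * d)))); last first.
    by rewrite ler_powR ?ler1n // -natr1 mulrDl mul1r -/d; lra.
  rewrite powRD ?p0 ?implybT // -/(lambda s) -/lam.
  apply: (@le_trans _ _ (lam * (1 - 2 * d))); last by rewrite ler_pM2l.
  by nra.
apply: (@le_trans _ _ (2 `^ (- s + 2 * d))).
  by rewrite ler_powR ?ler1n // -subn1 natrB // mulrBl mul1r -/d; lra.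
set z := 2 `^ _; have z0 : 0 < z by rewrite powR_gt0.
have lE : lam = z * 2 `^ (- (2 * d)).
  by rewrite -powRD ?p0 ?implybT // addrK.
have : z * (1 - 2 * d) <= lam by rewrite lE ler_pM2l.
have d3 : 2 * d < 1 by nra.
move=> zl; rewrite -(@ler_pM2r _ (1 - 2 * d)) ?subr_gt0 //.
by apply: le_trans zl _; nra.
Qed.

(** By continuity in lambda. The upper end uses [t + 2] because (t+1)/2^e may equal lambda, and
    [brackets_complete] needs strictness. *)
Lemma lambda_approx z (A : seq (seq bool)) :
  z < (1 - 2 * lam) * (\sum_(p <- A) lam ^+ size p) ->
  exists e t, [/\ t%:R / 2 ^+ e < lam, lam < (t + 2)%:R / 2 ^+ e &
    z < (1 - 2 * ((t + 2)%:R / 2 ^+ e)) * (\sum_(p <- A) (t%:R / 2 ^+ e) ^+ size p)].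
Proof.
move=> zA; have l0 : 0 < lam by exact: lambda_gt0.
have P2 n : 0 < 2 ^+ n :> R by rewrite exprn_gt0.
have /choice[t tP] : forall e, exists t : nat, t%:R < lam * 2 ^+ e <= t.+1%:R.
  by move=> e; apply: exists_ceil; rewrite mulr_gt0.
pose u e : R := (t e)%:R / 2 ^+ e; pose v e : R := (t e + 2)%:R / 2 ^+ e.
have uv e : [/\ u e < lam, lam < v e, lam - u e <= (2 ^+ e)^-1 & v e - lam <= 2 * (2 ^+ e)^-1].
  have /andP[h1 h2] := tP e; have d0 : 0 < (2 ^+ e)^-1 :> R by rewrite invr_gt0.
  have vE : v e = u e + 2 * (2 ^+ e)^-1 by rewrite /v natrD mulrDl.
  have h3 : u e < lam by rewrite ltr_pdivrMr.
  have h4 : lam <= u e + (2 ^+ e)^-1.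
    by rewrite -[X in _ + X]mul1r -mulrDl ler_pdivlMr // natr1.
  by split=> //; rewrite ?vE; lra.
have cu : u n @[n --> \oo] --> lam.
  apply/cvgrPdist_lt => eps eps0; have [N hN] := exp2_small eps0.
  exists N => // n /= Nn; have [h1 _ h3 _] := uv n.
  by rewrite gtr0_norm ?subr_gt0 //; apply: le_lt_trans h3 (hN n Nn).
have cv : v n @[n --> \oo] --> lam.
  apply/cvgrPdist_lt => eps eps0.
  have [N hN] := @exp2_small _ (eps / 2) ltac:(by rewrite divr_gt0).
  exists N => // n /= Nn; have [_ h2 _ h4] := uv n.
  rewrite distrC gtr0_norm ?subr_gt0 //; apply: le_lt_trans h4 _.
  by rewrite mulrC -ltr_pdivlMr // hN.
have cS : \sum_(p <- A) u n ^+ size p @[n --> \oo] --> \sum_(p <- A) lam ^+ size p.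
  elim: A {zA} => [|p A IH].
    by rewrite big_nil; under eq_fun do rewrite big_nil; exact: cvg_cst.
  rewrite big_cons; under eq_fun do rewrite big_cons; apply: cvgD => //.
  elim: (size p) => [|n IHn]; first by rewrite expr0; exact: cvg_cst.
  by rewrite exprS; under eq_fun do rewrite exprS; apply: cvgM.
have c1 : (1 - 2 * v n) * (\sum_(p <- A) u n ^+ size p) @[n --> \oo] -->
    (1 - 2 * lam) * (\sum_(p <- A) lam ^+ size p).
  apply: cvgM => //; apply: cvgB; first exact: cvg_cst.
  by apply: cvgM => //; exact: cvg_cst.
have [N _ hN] := cvgr_gt _ c1 _ zA.
exists N, (t N); have [h1 h2 _ _] := uv N; split=> //.
exact: (hN N (leqnn N)).
Qed.

(** As s > 1 >= 2^-j, no value <= 0 is close enough to s. So the sign bit is clear, and [a.-1] in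
    [brackets] is a true predecessor. *)
Lemma dyadic_bin_value j y : `|s - dyadic R j y| <= 2 ^- j ->
  (0 < bin_value y)%N /\ `|s - (bin_value y)%:R / 2 ^+ j| <= (2 ^+ j)^-1.
Proof.
have P2 : 1 <= 2 ^+ j :> R by rewrite exprn_ege1 // ler1n.
have Pi : (2 ^+ j)^-1 <= 1 :> R by rewrite invf_le1 // (lt_le_trans ltr01).
have small z : z <= 0 -> ~ `|s - z| <= (2 ^+ j)^-1.
  move=> z0; rewrite ler_norml => /andP[_ h].
  by have := le_trans h Pi; move: z0 s_gt1; lra.
case: y => [|[] y].
- by rewrite /dyadic /= expr0 mulr0n mulr0 mul0r => /small; case.
- rewrite /dyadic /= expr1 => /small; case.
  by rewrite mulN1r mulNr oppr_le0 divr_ge0 // (le_trans ler01).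
rewrite /dyadic /= expr0 mul1r.
have -> : bin_value (false :: y) = bin_value y by [].
move=> h; split=> //; rewrite lt0n; apply/negP => /eqP y0.
by move: h; rewrite y0 mul0r => /small; case.
Qed.

End Approximation.

(** * The two searches *)

Definition code_len c := trunc_log 2 c.+1.
Definition code_num c := (c.+1 - 2 ^ code_len c)%N.

Lemma code_len_code x : code_len (code x) = size x.
Proof. exact: trunc_log_code. Qed.

Lemma code_num_code x : code_num (code x) = bin_value x.
Proof. by rewrite /code_num code_len_code code_bin_value addnK. Qed.

(** Lets the search feed the precision, as a unary string, to a simulation that takes codes. *)
Lemma code_nseq_true j : code (nseq j true) = (2 ^ j.+1 - 2)%N.
Proof.
elim: j => // j IH; rewrite -addn1 nseqD cats1 code_rcons IH addn1.
by rewrite (expnS 2 j.+1); have := expn_gt0 2 j; rewrite expnS; lia.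
Qed.

Lemma size_le_code x : (size x <= code x)%N.
Proof.
have /andP[h _] := code_bounds x.
by have := ltn_expl (size x) (isT : 1 < 2)%N; lia.
Qed.

(* Below, [G q N] is the bounded simulation of the machine on the string with
   code [q] for [N] steps; numbers [n] encode the tuple [N, j, e, t]. *)
Definition fresh (G : nat -> nat -> nat) (N : nat) : nat :=
  (\sum_(q < N) G q N).+1%N.

(** The sum of (t/2^e)^|q| over the halted programs, scaled by 2^(e N) to an integer. *)
Definition mass (G : nat -> nat -> nat) (N e t : nat) : nat :=
  (\sum_(q < N) (0 < G q N) * (t ^ code_len q * 2 ^ (e * (N - code_len q))))%N.

(** The certificate, with all denominators cleared. If 2(t+2) >= 2^e, truncated subtraction gives 0
    and the strict test fails, as it should: the real factor is then not positive. *)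
Definition crosses (G H : nat -> nat -> nat) (w n : nat) : bool :=
  let N := vec_nth n 0 in let j := vec_nth n 1 in
  let e := vec_nth n 2 in let t := vec_nth n 3 in
  let x := (G w N).-1 in let y := (H (2 ^ j.+1 - 2)%N N).-1 in
  [&& 0 < G w N, 0 < H (2 ^ j.+1 - 2)%N N, brackets t e j (code_num y) &
    code_num x * 2 ^ (e * N + e) <
    mass G N e t * (2 ^ e - 2 * (t + 2)) * 2 ^ code_len x]%N.

(** All strings of length at most twice that of the input have codes below [B], and [B <= N] puts
    them within the range of [fresh]. *)
Definition exhausts (G : nat -> nat -> nat) (w n : nat) : bool :=
  let N := vec_nth n 0 in let B := (2 ^ (2 * code_len w).+1)%N in
  (B <= N)%N && ~~ [exists q : 'I_B, G q N == 0%N].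

Section Computability.
Local Open Scope nat_scope.
Local Notation E := register_computable.
Variables G H : nat -> nat -> nat.
Hypotheses (G_comp : computable2 G) (H_comp : computable2 H).

Lemma code_len_computable : computable1 code_len.
Proof. by move=> a Ea; exact: trunc_log_computable. Qed.

Lemma code_num_computable : computable1 code_num.
Proof.
move=> a Ea; apply: subn_computable; first exact: succ_computable.
by apply: expn_computable; [exact: const_computable | exact: code_len_computable].
Qed.

Lemma fresh_computable : computable1 (fresh G).
Proof.
apply: computable1P; apply: succ_computable; have V := var_computable.
apply: (@sum_computable _ (fun q v => G q (nth 0 v 0))) => //.
by apply: G_comp => //; exact: weaken_computable (V 0).
Qed.

Lemma mass_computable N e t : E N -> E e -> E t ->
  E (fun v => mass G (N v) (e v) (t v)).
Proof.
move=> EN Ee Et; have V := var_computable; have C := const_computable.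
apply: (@sum_computable _ (fun q v => (0 < G q (N v)) *
  (t v ^ code_len q * 2 ^ (e v * (N v - code_len q))))) => //.
have EN' := weaken_computable EN; have Ee' := weaken_computable Ee.
have Et' := weaken_computable Et.
have El := code_len_computable (V 0).
apply: muln_computable.
  by apply: ltn_computable => //; exact: G_comp.
apply: muln_computable; first exact: expn_computable.
apply: expn_computable => //; apply: muln_computable => //.
exact: subn_computable.
Qed.

Lemma brackets_computable t e j a : E t -> E e -> E j -> E a ->
  E (fun v => brackets (t v) (e v) (j v) (a v)).
Proof.
move=> Et Ee Ej Ea; have C := const_computable.
have Epow f : E f -> E (fun v => 2 ^ f v) by move=> Ef; exact: expn_computable.
have Er : E (fun v => 2 ^ (e v * 2 ^ j v)).
  by apply: (Epow); apply: muln_computable => //; exact: Epow.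
apply: andb_computable; apply: leq_computable => //; apply: muln_computable.
- by apply: expn_computable => //; exact: Epow.
- exact/Epow/succ_computable.
- by apply: expn_computable; [exact: addn_computable | exact: Epow].
- exact/Epow/pred_computable.
Qed.

Lemma crosses_computable : computable2 (fun w n => crosses G H w n).
Proof.
move=> w n Ew En; have C := const_computable.
have Epow f : E f -> E (fun v => 2 ^ f v) by move=> Ef; exact: expn_computable.
have EN i : E (fun v => vec_nth (n v) i) := vec_nth_computable i En.
have EG := G_comp Ew (EN 0).
have EH : E (fun v => H (2 ^ (vec_nth (n v) 1).+1 - 2) (vec_nth (n v) 0)).
  by apply: H_comp => //; apply: subn_computable => //; exact/Epow/succ_computable.
apply: andb_computable; first exact: ltn_computable.
apply: andb_computable; first exact: ltn_computable.
apply: andb_computable.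
  by apply: brackets_computable => //; exact/code_num_computable/pred_computable.
apply: ltn_computable.
  apply: muln_computable; first exact/code_num_computable/pred_computable.
  by apply: (Epow); apply: addn_computable => //; exact: muln_computable.
apply: muln_computable; last exact/Epow/code_len_computable/pred_computable.
apply: muln_computable; first exact: mass_computable.
apply: subn_computable; first exact: Epow.
by apply: muln_computable => //; exact: addn_computable.
Qed.

Lemma exhausts_computable : computable2 (fun w n => exhausts G w n).
Proof.
move=> w n Ew En; have C := const_computable; have V := var_computable.
have EN := vec_nth_computable 0 En.
have EB : E (fun v => 2 ^ (2 * code_len (w v)).+1).
  apply: expn_computable => //; apply: succ_computable.
  by apply: muln_computable => //; exact: code_len_computable.
apply: andb_computable; first exact: leq_computable.
apply: negb_computable.
apply: (@has_computable _ (fun q v => G q (vec_nth (n v) 0) == 0)) => //.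
by apply: eq0_computable; apply: G_comp => //; exact: weaken_computable EN.
Qed.

End Computability.

(** * The part of the domain seen by a bounded simulation *)

Section Halted.
Variables (T : TM) (G : nat -> nat -> nat).
Hypothesis GE : forall x n, G (code x) n = bounded_output T x n.

Definition decode (n : nat) : seq bool := projT1 (cid (code_surj n)).

Lemma decodeK n : code (decode n) = n.
Proof. by rewrite /decode; case: cid. Qed.

Lemma codeK x : decode (code x) = x.
Proof. by apply: code_inj; rewrite decodeK. Qed.

Definition halted N := [seq decode q | q <- iota 0 N & (0 < G q N)%N].

Lemma mem_halted N p : (p \in halted N) = (code p < N)%N && tm_halts T p N.
Proof.
apply/mapP/andP => [[q]|[pN hp]].
  rewrite mem_filter mem_iota /= => /andP[Gq qN] ->.
  by rewrite decodeK qN -bounded_output_gt0 -GE decodeK.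
exists (code p); last by rewrite codeK.
by rewrite mem_filter mem_iota pN GE bounded_output_gt0 hp.
Qed.

Lemma halted_uniq N : uniq (halted N).
Proof.
rewrite map_inj_uniq; first by rewrite filter_uniq ?iota_uniq.
by move=> a b ab; rewrite -(decodeK a) ab decodeK.
Qed.

Lemma halted_dom N p : p \in halted N -> tm_dom T p.
Proof. by rewrite mem_halted => /andP[_ hp]; exists N. Qed.

Lemma halted_exhaust (A : seq (seq bool)) : (forall p, p \in A -> tm_dom T p) ->
  exists N0, forall N, (N0 <= N)%N -> {subset A <= halted N}.
Proof.
elim: A => [|p A IH] AD; first by exists 0%N.
have [|N1 hN1] := IH; first by move=> q qA; apply: AD; rewrite inE qA orbT.
have [k hk] := AD p (mem_head _ _).
exists (maxn N1 (maxn k (code p).+1)) => N; rewrite !geq_max => /and3P[h1 h2 h3] q.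
rewrite inE => /orP[/eqP->|]; last exact: hN1.
by rewrite mem_halted h3 (tm_halts_mono h2 hk).
Qed.

(** An output of a program in [halted N] has a code one less than some summand of [fresh], hence a
    smaller code than [y]. *)
Lemma fresh_notin N p y : computes T p y -> code y = fresh G N ->
  p \notin halted N.
Proof.
move=> py yE; apply/negP; rewrite mem_halted => /andP[pN hp].
have := computes_bounded_output py hp; rewrite -GE yE => GpE.
suff : (G (code p) N <= \sum_(q < N) G q N)%N by rewrite GpE /fresh; lia.
by rewrite (bigD1 (Ordinal pN)) //= leq_addr.
Qed.

Lemma mass_halted (R : realType) N e t :
  (mass G N e t)%:R / 2 ^+ (e * N) =
  \sum_(p <- halted N) (t%:R / 2 ^+ e) ^+ size p :> R.
Proof.
rewrite /mass /halted big_map big_filter [RHS]big_mkcond.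
have -> : iota 0 N = index_iota 0 N by rewrite /index_iota subn0.
rewrite big_mkord natr_sum mulr_suml; apply: eq_bigr => q _.
case: ifP => _; last by rewrite mul0n mul0r.
have qE : code_len q = size (decode q) by rewrite -code_len_code decodeK.
(* A length is at most the code, so the subtraction in [mass] does not truncate. *)
have qN : (code_len q <= N)%N.
  by rewrite qE (leq_trans (size_le_code _)) // decodeK ltnW.
rewrite mul1n -qE natrM !natrX exprMn exprVn -exprM.
have -> : 2 ^+ (e * N) =
    2 ^+ (e * (N - code_len q)) * 2 ^+ (e * code_len q) :> R.
  by rewrite -exprD -mulnDr subnK.
field.
by rewrite !expf_neq0 ?pnatr_eq0.
Qed.

End Halted.

Lemma crossing_test (R : realType) (k m e t N S : nat) :
  (k * 2 ^ (e * N + e) < S * (2 ^ e - 2 * (t + 2)) * 2 ^ m)%N =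
  (k%:R / 2 ^+ m <
   (1 - 2 * ((t + 2)%:R / 2 ^+ e)) * (S%:R / 2 ^+ (e * N)) :> R).
Proof.
have P2 n : 0 < 2 ^+ n :> R by rewrite exprn_gt0.
have hE : (1 - 2 * ((t + 2)%:R / 2 ^+ e)) * (S%:R / 2 ^+ (e * N)) =
    (2 ^+ e - 2 * (t + 2)%:R) * S%:R / 2 ^+ (e * N + e) :> R.
  rewrite exprD; field.
  by rewrite !expf_neq0 ?pnatr_eq0.
rewrite hE ltr_pdivrMr // mulrAC ltr_pdivlMr //.
have [le|lt] := leqP (2 ^ e) (2 * (t + 2)).
  have -> : (2 ^ e - 2 * (t + 2) = 0)%N by lia.
  rewrite muln0 mul0n ltn0; apply/esym/negbTE; rewrite -leNgt.
  apply: (@le_trans _ _ 0); last by rewrite mulr_ge0 // ltW.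
  rewrite mulr_le0_ge0 ?(ltW (P2 _)) // mulr_le0_ge0 // subr_le0.
  by rewrite -natrX -natrM ler_nat.
rewrite -(ltr_nat R) !natrM natrB ?(ltnW lt) // !natrX natrM.
by rewrite [S%:R * _]mulrC.
Qed.

(** * Bounds on kappa and on the complexity of its digits *)

Section Machines.
Variables (R : realType) (T : TM) (s : R).
Hypotheses (T_universal : universal_for (fun=> True) T) (s_gt1 : 1 < s).
Hypothesis s_computable : computable_real s.
Let lam := lambda s.

Let lam_gt0 : 0 < lam. Proof. exact: lambda_gt0. Qed.
Let coef_gt0 : 0 < 1 - 2 * lam. Proof. by rewrite subr_gt0 lambda_lt. Qed.

Lemma universal_dom : exists p, tm_dom T p.
Proof.
have [n hn _] : computes (prog_TM Skip) [::] [::].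
  by apply: (@exec_computes Skip [::] (input_store [::])); exact: ExecSkip.
have [c hc] := @T_universal (prog_TM Skip) I.
have [|p [pD _ _]] := hc [::]; first by exists n.
by exists p.
Qed.

Lemma universal_not_total : exists p, ~ tm_dom T p.
Proof.
apply: contrapT => nex; have total p : tm_dom T p.
  by apply: contrapT => np; apply: nex; exists p.
have [G G_comp GE] := simulation_computable T.
have [|C hC] := @search_TM _ (fun _ n => fresh G (vec_nth n 0))
  (exhausts_computable G_comp).
  by move=> a b _ Eb; apply: fresh_computable => //; exact: vec_nth_computable.
(* An input of length c makes the bound |x| + c equal to 2|x|, the length covered by [exhausts]. *)
have [c hc] := @T_universal C I; pose x := nseq c true.
pose B := (2 ^ (2 * size x).+1)%N.
have [N0 hN0] := halted_exhaust GE (A := [seq decode q | q <- iota 0 B]) (fun p _ => total p).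
pose N := maxn N0 B.
have inN q : (q < B)%N -> tm_halts T (decode q) N.
  move=> qB; have := hN0 N (leq_maxl _ _) (decode q).
  by rewrite (mem_halted GE) map_f ?mem_iota // => /(_ isT) /andP[].
have Pn : (0 < exhausts G (code x) (vec [:: N]))%N.
  rewrite lt0b /exhausts vec_nthE // code_len_code leq_maxr /=.
  apply/existsPn => q; rewrite -[q : nat]decodeK GE -lt0n bounded_output_gt0.
  exact: inN.
have [n + [y yE Cxy]] := hC x _ Pn.
rewrite lt0b => /andP[BN /existsPn noq].
have xD : tm_dom C x by case: Cxy => k hk _; exists k.
have [p [_ psz py]] := hc x xD.
have := fresh_notin GE (py y Cxy) yE; rewrite (mem_halted GE).
have pB : (code p < 2 ^ (2 * code_len (code x)).+1)%N.
  have /andP[_ h] := code_bounds p; apply: leq_trans (_ : _ <= 2 ^ (size p).+1)%N _.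
    exact: ltnW.
  rewrite leq_exp2l // ltnS code_len_code mul2n -addnn {1}size_nseq.
  by rewrite addnC; exact: psz.
rewrite (leq_trans pB BN) -bounded_output_gt0 -GE lt0n.
by have := noq (Ordinal pB); rewrite /= => ->.
Qed.

Lemma kappa_itv : 0 < kappa T s < 1.
Proof.
apply/andP; split.
  have [p pD] := universal_dom.
  apply: lt_le_trans (sum_le_kappa s_gt1 (A := [:: p]) isT _).
    by rewrite big_seq1 mulr_gt0 // exprn_gt0.
  by move=> q; rewrite inE => /eqP->.
(* The weight of one program outside the domain is missing from a total of at most 1. *)
have [p pD] := universal_not_total.
have ep : 0 < (1 - 2 * lam) * lam ^+ size p by rewrite mulr_gt0 // exprn_gt0.
apply: le_lt_trans (_ : _ <= 1 - (1 - 2 * lam) * lam ^+ size p) _; last first.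
  by rewrite gtrBl.
apply: kappa_le => // A Au AD; rewrite lerBrDl -mulrDr.
have pAu : uniq (p :: A) by rewrite /= Au andbT; apply/negP => /AD.
by have := sum_weight_le1 lam_gt0 (lambda_lt s_gt1) pAu; rewrite big_cons.
Qed.

Lemma kappa_K_random : K_random T (1 / s) (kappa T s).
Proof.
split; first exact: kappa_itv.
have [b bexp bP] := unending_expansion_exists kappa_itv.
exists b => //.
have [M hM] := s_computable.
have [G G_comp GE] := simulation_computable T.
have [H H_comp HE] := simulation_computable M.
have [|C hC] := @search_TM _ (fun _ n => fresh G (vec_nth n 0))
  (crosses_computable G_comp H_comp).
  by move=> a a' _ Ea'; apply: fresh_computable => //; exact: vec_nth_computable.
have [c hc] := @T_universal C I.
have [d hd] := exp2_small coef_gt0; have {}hd := hd d (leqnn d).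
have s0 : 0 < s by exact: lt_trans s_gt1.
have P2 n : 0 < 2 ^+ n :> R by rewrite exprn_gt0.
exists (c%:R + d%:R / s); first by rewrite addr_ge0 // divr_ge0 // ltW.
move=> m _; apply: le_ereal_inf_tmp => _ [w wx <-]; rewrite lee_fin.
have /andP[k_lt k_le] := bP m.
set x := mkseq b m in wx k_lt k_le; set k := bin_value x in k_lt k_le.
have szx : size x = m by rewrite size_mkseq.
have [n Pn] : exists n, (0 < crosses G H (code w) n)%N.
  have : k%:R / 2 ^+ m < kappa T s by rewrite ltr_pdivrMr.
  move=> /(lt_kappa_sum s_gt1)[A [Au AD]] /lambda_approx[e [t [tl lt zA]]].
  have [j hj] := brackets_complete tl lt.
  have [y My] := hM j; move=> /(dyadic_bin_value s_gt1)[y0 /(hj _ y0) br].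
  have [N0 hN0] := halted_exhaust GE AD.
  have [nw hw _] := wx; have [nM hMj _] := My.
  pose N := maxn N0 (maxn nw nM).
  have hwN : tm_halts T w N.
    by apply: tm_halts_mono hw; rewrite /N !leq_max leqnn orbT.
  have hMN : tm_halts M (nseq j true) N.
    by apply: tm_halts_mono hMj; rewrite /N !leq_max leqnn !orbT.
  exists (vec [:: N; j; e; t]); rewrite lt0b /crosses !vec_nthE //=.
  rewrite -code_nseq_true GE HE (computes_bounded_output wx hwN).
  rewrite (computes_bounded_output My hMN) /= !code_num_code br /=.
  rewrite code_len_code szx (crossing_test R) mass_halted.
  apply: (lt_le_trans zA).
  (* Adding programs raises the value only for a nonnegative factor; a negative one would contradict
     [zA], whose left side is nonnegative. *)
  have h0 : 0 <= 1 - 2 * ((t + 2)%:R / 2 ^+ e) :> R.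
    rewrite leNgt; apply/negP => hneg; move: zA; rewrite ltNge => /negP; apply.
    apply: (@le_trans _ _ 0); last by rewrite divr_ge0 // ltW.
    apply: mulr_le0_ge0; first exact: ltW.
    by apply: sumr_ge0 => p _; rewrite exprn_ge0 // divr_ge0 // ltW.
  apply: ler_wpM2l => //.
  have -> : \sum_(p <- A) (t%:R / 2 ^+ e) ^+ size p =
      \sum_(p <- halted G N | p \in A) (t%:R / 2 ^+ e) ^+ size p :> R.
    rewrite -[RHS]big_filter; apply: perm_big; apply: uniq_perm => //.
      by rewrite filter_uniq ?(halted_uniq G).
    move=> p; rewrite mem_filter; case pA: (p \in A) => //=.
    by rewrite (hN0 N) // /N leq_max leqnn.
  rewrite big_mkcond; apply: ler_sum => p _; case: ifP => // _.
(* The hit need not be the tuple built above, so only the test itself is used from here on. *)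
have {n Pn}[n + [y yE Cwy]] := hC w n Pn.
rewrite lt0b /crosses; set N := vec_nth n 0; set j := vec_nth n 1.
set e := vec_nth n 2; set t := vec_nth n 3.
rewrite -code_nseq_true GE HE !bounded_output_gt0 => /and4P[hw hMj].
have [y' My' /(dyadic_bin_value s_gt1)[y'0 y'E]] := hM j.
rewrite (computes_bounded_output My' hMj) (computes_bounded_output wx hw) /=.
rewrite !code_num_code code_len_code szx => /(brackets_sound y'0 y'E)/andP[tl lt].
rewrite (crossing_test R) mass_halted -/k => cross.
have wD : tm_dom C w by case: Cwy => i hi _; exists i.
have [p [pD psz py]] := hc w wD.
have pnew := fresh_notin GE (py y Cwy) yE.
have pu : uniq (p :: halted G N) by rewrite /= pnew halted_uniq.
have := sum_le_kappa s_gt1 pu; rewrite big_cons mulrDr => bound.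
have {}bound : (1 - 2 * lam) * lam ^+ size p +
    (1 - 2 * lam) * (\sum_(q <- halted G N) lam ^+ size q) <= kappa T s.
  apply: bound => q; rewrite inE => /orP[/eqP->//|]; exact: (halted_dom GE).
(* The certified value is a lower bound: (t+2)/2^e >= lambda shrinks the factor, and t/2^e <= lambda
   shrinks the powers. *)
have {}cross : k%:R / 2 ^+ m < (1 - 2 * lam) * (\sum_(q <- halted G N) lam ^+ size q).
  apply: lt_le_trans cross _; apply: (@le_trans _ _ ((1 - 2 * lam) *
    (\sum_(q <- halted G N) (t%:R / 2 ^+ e) ^+ size q))).
    apply: ler_wpM2r.
      by apply: sumr_ge0 => q _; rewrite exprn_ge0 // divr_ge0 // ltW.
    by rewrite lerD2l lerN2 ler_pM2l.
  rewrite ler_pM2l //; apply: ler_sum => q _.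
  by rewrite lerXn2r ?nnegrE ?(ltW lam_gt0) // divr_ge0 // ltW.
have le_m : kappa T s <= k%:R / 2 ^+ m + (2 ^+ m)^-1.
  by rewrite -[X in _ + X]mul1r -mulrDl ler_pdivlMr // natr1.
have small : (1 - 2 * lam) * lam ^+ size p < (2 ^+ m)^-1.
  have := le_trans bound le_m; rewrite -lerBrDr => /le_lt_trans; apply.
  by rewrite ltrBlDr [ltRHS]addrC ltrD2r.
(* Replacing the factor 1 - 2 lambda by the smaller 2^-d leaves powers of 2, whose exponents can be
   compared. *)
have small2 : 2 `^ (- (d%:R + s * (size p)%:R)) < 2 `^ (- m%:R) :> R.
  rewrite [ltRHS]powRN powR_mulrn // opprD powRD ?pnatr_eq0 ?implybT //.
  rewrite -mulNr powR_lambda powRN powR_mulrn //; apply: le_lt_trans small.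
  by rewrite ler_pM2r ?exprn_gt0 // ltW.
have m_lt : m%:R < d%:R + s * (size p)%:R.
  rewrite ltNge; apply/negP => h; move: small2; rewrite ltNge => /negP; apply.
  by rewrite ler_powR ?ler1n // lerN2.
have {}psz : (size p)%:R <= (size w)%:R + c%:R :> R by rewrite -natrD ler_nat.
have ms_lt : m%:R / s < d%:R / s + (size p)%:R.
  by rewrite ltr_pdivrMr // mulrDl divfK ?gt_eqF // [_%:R * s]mulrC.
rewrite mul1r lerBlDr; apply: ltW; apply: lt_le_trans ms_lt _.
by rewrite addrA [leRHS]addrC lerD2l.
Qed.

End Machines.

Theorem theorem36 (R : realType) (T : TM) (s : R)
  (T_universal : universal_for (fun=> True) T)
  (s_gt1 : 1 < s) (s_computable : computable_real s) :
  K_random T (1 / s) (kappa T s).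
Proof. exact: kappa_K_random. Qed.
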